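(* Let $k\in\mathbb N$. There exists $c>0$ such that, as $n\to\infty$ (with $r=r(n)$), $$\mathbb E[S_{n,k}]=I_{n,k}\big(1+O(e^{-cnr^d})\big).$$
   Context: Setting. Let $d\in\mathbb N$; $\mathrm{Vol}$ is Lebesgue measure, $\theta$ is the volume of the unit-radius ball in $\mathbb R^d$. Let $A\subset\mathbb R^d$ be compact with $\mathrm{Vol}(A)>0$. If $d\ge2$, $A$ has a $C^{1,1}$ boundary: for each $x\in\partial A$ there are a neighbourhood $U$ of $x$ and a real-valued function $\phi$, defined on an open set in $\mathbb R^{d-1}$ and differentiable with Lipschitz continuous partial derivatives, such that $\partial A\cap U$, after a rotation, is the graph of $\phi$. If $d=1$, $A$ is an interval. Let $X_1,X_2,\ldots$ be i.i.d. random vectors in $\mathbb R^d$ with distribution $\nu$ having density $f$ and support $A$, with $f$ continuous on $A$. Put $f_0=\inf_Af$, $f_1=\inf_{\partial A}f$, and assume $f_0>0$. For $n\in\mathbb N$ let $\mathcal X_n=\{X_1,\ldots,X_n\}$; for real $n>0$ let $Z_n$ be Poisson with mean $n$, independent of $(X_i)$, and $\mathcal P_n=\{X_1,\ldots,X_{Z_n}\}$ (a Poisson process with intensity $nf$). For finite $\mathcal X\subset\mathbb R^d$ and $r>0$, $G(\mathcal X,r)$ is the graph on $\mathcal X$ with an edge between each pair of distinct points at Euclidean distance at most $r$, and $K_{k,r}(\mathcal X)$ is the number of connected components of $G(\mathcal X,r)$ with exactly $k$ vertices. Put $S_{n,k}=K_{k,r(n)}(\mathcal X_n)$, $S'_{n,k}=K_{k,r(n)}(\mathcal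 P_n)$, $I_{n,k}=\mathbb E[S'_{n,k}]$. The sequence $r=r(n)>0$ satisfies $\lim_{n\to\infty}nr(n)^d=\infty$ and $\limsup_{n\to\infty}\frac{\theta nr(n)^d}{\log n}<\frac1{\max(f_0,\,d(f_0-f_1/2))}$. *)

(* Defs.v *)
From HB Require Import structures.
From mathcomp Require Import all_boot all_order all_algebra finmap.
From mathcomp Require Import all_classical all_reals all_analysis.
From mathcomp Require Import measurable_realfun.

Set Implicit Arguments.
Unset Strict Implicit.
Unset Printing Implicit Defensive.

Import Order.TTheory GRing.Theory Num.Theory.
Import numFieldNormedType.Exports.

Local Open Scope classical_set_scope.
Local Open Scope ring_scope.

Section measurable_rV.
Context {d} {T : sigmaRingType d}.
Variable n : nat.

Let coord : 'I_n -> 'rV[T]_n -> T := fun i v => v ord0 i.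

Let rV_set0 : g_sigma_preimage coord set0.
Proof. exact: sigma_algebra0. Qed.

Let rV_setC A : g_sigma_preimage coord A -> g_sigma_preimage coord (~` A).
Proof. exact: sigma_algebraC. Qed.

Let rV_bigcup (F : _^nat) : (forall i, g_sigma_preimage coord (F i)) ->
  g_sigma_preimage coord (\bigcup_i (F i)).
Proof. exact: sigma_algebra_bigcup. Qed.

(* The product sigma-algebra; for T := R it is the Borel sigma-algebra of R^n. *)
HB.instance Definition _ := @isMeasurable.Build (measure_tuple_display d)
  'rV[T]_n (g_sigma_preimage coord) rV_set0 rV_setC rV_bigcup.

End measurable_rV.

Lemma measurable_coord d (T : sigmaRingType d) n (i : 'I_n) :
  measurable_fun setT (fun v : 'rV[T]_n => v ord0 i).
Proof.
move=> _ Y mY; rewrite setTI; apply: sub_sigma_algebra => /=.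
rewrite -bigcup_seq/=; exists i => /=; first by rewrite mem_index_enum.
by exists Y => //; rewrite setTI.
Qed.

Lemma measurable_fun_rVP d1 d2 (T1 : measurableType d1) (T2 : measurableType d2)
    n (f : T1 -> 'rV[T2]_n) :
  (forall i, measurable_fun setT (fun x => f x ord0 i)) -> measurable_fun setT f.
Proof.
move=> mf _ Y mY; rewrite setTI.
suff : measurable `<=` [set Y : set 'rV[T2]_n | measurable (f @^-1` Y)] by exact.
apply: smallest_sub.
  split=> /=.
  - by rewrite preimage_set0; exact: measurable0.
  - by move=> B mB; rewrite setTD preimage_setC; exact: measurableC.
  - by move=> F mF; rewrite preimage_bigcup; exact: bigcup_measurable.
move=> B; rewrite -bigcup_seq => -[i _ [C mC <-]] /=.
by rewrite setTI -[X in measurable X]setTI; exact: mf.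
Qed.

(* Lebesgue measure on R^n as the n-fold product of Lebesgue measure on R: the
   measure of A is the integral over x of the measure of the slice of A at first
   coordinate x. It is shown below to be a sigma-finite measure that gives boxes
   their usual volume. *)
Fixpoint lebesgue_rV (R : realType) (n : nat) : set 'rV[R]_n -> \bar R :=
  if n is n'.+1 then fun A =>
    (\int[lebesgue_measure]_(x in [set: R])
       lebesgue_rV [set v : 'rV[R]_n' | A (row_mx x%:M v)])%E
  else \d_(0 : 'rV[R]_0).

Section cons_rV.
Context {R : realType}.
Variable n : nat.

Let cons_rV (p : R * 'rV[R]_n) : 'rV[R]_n.+1 := row_mx p.1%:M p.2.

Let uncons_rV (v : 'rV[R]_n.+1) : R * 'rV[R]_n :=
  (v ord0 ord0, \row_i v ord0 (lift ord0 i)).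

Let cons_rV0 p : cons_rV p ord0 ord0 = p.1.
Proof.
have -> : ord0 = lshift n ord0 :> 'I_(1 + n) by exact/val_inj.
by rewrite [LHS]row_mxEl mxE.
Qed.

Let cons_rVS p i : cons_rV p ord0 (lift ord0 i) = p.2 ord0 i.
Proof.
have -> : lift ord0 i = rshift 1 i :> 'I_(1 + n) by exact/val_inj.
exact: row_mxEr.
Qed.

Let cons_rVK : cancel cons_rV uncons_rV.
Proof.
move=> p; rewrite /uncons_rV cons_rV0 [RHS]surjective_pairing; congr pair.
by apply/rowP => i; rewrite mxE cons_rVS.
Qed.

Let measurable_cons_rV : measurable_fun setT cons_rV.
Proof.
apply: measurable_fun_rVP => i; have [j ->|->] := unliftP ord0 i.
  under eq_fun do rewrite cons_rVS.
  exact: (measurableT_comp (measurable_coord j)).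
under eq_fun do rewrite cons_rV0.
exact: measurable_fst.
Qed.

Let measurable_uncons_rV : measurable_fun setT uncons_rV.
Proof.
apply/measurable_fun_pair; first exact: measurable_coord.
apply: measurable_fun_rVP => i; under eq_fun do rewrite mxE.
exact: measurable_coord.
Qed.

Variable mu : {sigma_finite_measure set 'rV[R]_n -> \bar R}.

Let m : set 'rV[R]_n.+1 -> \bar R :=
  pushforward (lebesgue_measure \x mu)%E cons_rV.

Let m0 : m set0 = 0%E. Proof. by rewrite /m /pushforward preimage_set0 measure0. Qed.
Let m_ge0 A : (0 <= m A)%E. Proof. exact: measure_ge0. Qed.
Let m_sigma_additive : semi_sigma_additive m.
Proof.
pose f : {mfun (R * 'rV[R]_n)%type >-> 'rV[R]_n.+1} :=
  HB.pack cons_rV (isMeasurableFun.Build _ _ _ _ cons_rV measurable_cons_rV).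
exact: (@measure_semi_sigma_additive _ _ _ (pushforward (lebesgue_measure \x mu)%E f)).
Qed.
#[local] HB.instance Definition _ := isMeasure.Build _ _ _ m m0 m_ge0 m_sigma_additive.

Let m_sigma_finite : sigma_finite setT m.
Proof.
have /sigma_finiteP[F [TF ndF Foo]] := sigma_finiteT (@lebesgue_measure R).
have /sigma_finiteP[G [TG ndG Goo]] := sigma_finiteT mu.
exists (fun k => uncons_rV @^-1` (F k `*` G k)).
  apply/esym; rewrite -subTset => v _; have [k _ Fk] : (\bigcup_k F k) (uncons_rV v).1.
    by rewrite -TF.
  have [l _ Gl] : (\bigcup_k G k) (uncons_rV v).2 by rewrite -TG.
  exists (maxn k l) => //; split.
  - by move: Fk; exact/subsetPset/ndF/leq_maxl.
  - by move: Gl; exact/subsetPset/ndG/leq_maxr.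
move=> k; have [mF Fk] := Foo k; have [mG Gk] := Goo k; split.
  rewrite -[X in measurable X]setTI; apply: measurable_uncons_rV => //.
  exact: measurableX.
rewrite /m /pushforward -comp_preimage (_ : _ \o _ = id) ?preimage_id.
  by rewrite product_measure1E// lte_mul_pinfty// ge0_fin_numE.
by apply/funext => p; exact: cons_rVK.
Qed.
#[local] HB.instance Definition _ := Measure_isSigmaFinite.Build _ _ _ m m_sigma_finite.

Lemma sigma_finite_cons_rV :
  exists nu : {sigma_finite_measure set 'rV[R]_n.+1 -> \bar R},
  nu = (fun A => \int[lebesgue_measure]_(x in [set: R])
          mu [set v | A (row_mx x%:M v)])%E :> (set _ -> \bar R).
Proof.
exists m; apply/funext => A; rewrite /= /m /pushforward /product_measure1.
by apply: eq_integral => x _ /=; congr (mu _); apply/seteqP; split => v /=;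
  rewrite /xsection /= inE.
Qed.

End cons_rV.

Section lebesgue_rV_measure.
Context {R : realType}.
Variable n : nat.
Local Notation mu := (@lebesgue_rV R n).

Let sigma_finite_lebesgue_rV :
  exists nu : {sigma_finite_measure set 'rV[R]_n -> \bar R},
  nu = mu :> (set _ -> \bar R).
Proof.
elim: n => [|k [nu nuE]] /=; first by exists (\d_(0 : 'rV[R]_0)).
have [nu' nu'E] := sigma_finite_cons_rV nu.
by exists nu'; rewrite nu'E nuE.
Qed.

Let mu0 : mu set0 = 0%E.
Proof. by have [nu <-] := sigma_finite_lebesgue_rV; exact: measure0. Qed.

Let mu_ge0 A : (0 <= mu A)%E.
Proof. by have [nu <-] := sigma_finite_lebesgue_rV; exact: measure_ge0. Qed.

Let mu_sigma_additive : semi_sigma_additive mu.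
Proof.
have [nu <-] := sigma_finite_lebesgue_rV.
exact: measure_semi_sigma_additive.
Qed.

HB.instance Definition _ :=
  isMeasure.Build _ _ _ mu mu0 mu_ge0 mu_sigma_additive.

Let mu_sigma_finite : sigma_finite setT mu.
Proof. by have [nu <-] := sigma_finite_lebesgue_rV; exact: sigma_finiteT. Qed.

HB.instance Definition _ := Measure_isSigmaFinite.Build _ _ _ mu mu_sigma_finite.

End lebesgue_rV_measure.

Lemma lebesgue_rV_box (R : realType) n (a b : 'I_n -> R) :
  (forall i, a i <= b i) ->
  lebesgue_rV [set v : 'rV[R]_n | forall i, v ord0 i \in `[a i, b i]] =
  (\prod_(i < n) (b i - a i))%:E.
Proof.
elim: n a b => [|n IH] a b ab.
  by rewrite big_ord0 /= diracE mem_set // => -[].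
rewrite big_ord_recl mulrC EFinM -IH => [|i]; last exact: ab.
set B := [set v : 'rV[R]_n | _].
rewrite [LHS](_ : _ = \int[lebesgue_measure]_(x in [set: R])
    (lebesgue_rV B * (\1_`[a ord0, b ord0] x)%:E))%E; last first.
  apply: eq_integral => x _; rewrite indicE.
  have rE v i : (row_mx x%:M v : 'rV[R]_n.+1) ord0 (lift ord0 i) = v ord0 i.
    have -> : lift ord0 i = rshift 1 i :> 'I_(1 + n) by exact/val_inj.
    exact: row_mxEr.
  have r0 (v : 'rV[R]_n) : (row_mx x%:M v : 'rV[R]_n.+1) ord0 ord0 = x.
    have -> : ord0 = lshift n ord0 :> 'I_(1 + n) by exact/val_inj.
    by rewrite [LHS]row_mxEl mxE.
  have [xab|xab] := boolP (x \in `[a ord0, b ord0]%classic).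
    rewrite mule1; congr lebesgue_rV; apply/seteqP; split=> v /= vB i.
      by rewrite -rE; exact: vB.
    by have [j ->|->] := unliftP ord0 i; rewrite ?rE ?r0 //; rewrite inE in xab.
  rewrite mule0 -[RHS](@measure0 _ _ _ (@lebesgue_rV R n)).
  congr lebesgue_rV; apply/seteqP; split=> v //= /(_ ord0); rewrite r0 => xI.
  by move/negP: xab; apply; rewrite inE.
rewrite ge0_integralZl//; first last.
  by apply/measurable_EFinP; exact: measurable_indic.
rewrite integral_indic// setIT; congr *%E.
rewrite [LHS]lebesgue_measure_itv/= lte_fin; case: ifPn => [_|]; first by rewrite EFinB.
by rewrite -leNgt => ba; rewrite (le_anti (introT andP (conj ba (ab _)))) subrr.
Qed.

(* Euclidean norm; the library norm `|v| on 'rV[R]_d is the sup norm. *)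
Definition enorm (R : realType) d (v : 'rV[R]_d) : R :=
  Num.sqrt (\sum_(i < d) v ord0 i ^+ 2).

Definition unit_ball_volume (R : realType) d : R :=
  fine (lebesgue_rV [set v : 'rV[R]_d | enorm v <= 1]).

Definition boundary (T : topologicalType) (A : set T) : set T :=
  closure A `\` interior A.

Definition rotation (R : realType) d (Q : 'M[R]_d) : Prop :=
  Q *m Q^T = 1%:M /\ \det Q = 1.

(* phi takes as argument the vector of all coordinates but the j-th one. *)
Definition graph_on (R : realType) d (j : 'I_d) (V : set 'rV[R]_d.-1)
    (phi : 'rV[R]_d.-1 -> R) : set 'rV[R]_d :=
  [set w | V (col' j w) /\ w ord0 j = phi (col' j w)].

Definition C11_on (R : realType) m (V : set 'rV[R]_m) (phi : 'rV[R]_m -> R) :=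
  (forall y, V y -> differentiable phi y) /\
  (forall i : 'I_m, exists L : R,
     L.-lipschitz_V (fun y : 'rV[R]_m => 'D_(delta_mx ord0 i) phi y)).

(* Rows are rotated by right multiplication; j.+1 = d says that j is the last
   coordinate, so the rotated piece of boundary is a graph over the others. *)
Definition C11_boundary (R : realType) d (A : set 'rV[R]_d) : Prop :=
  forall x, boundary A x ->
  exists (U : set 'rV[R]_d) (Q : 'M[R]_d) (j : 'I_d)
         (V : set 'rV[R]_d.-1) (phi : 'rV[R]_d.-1 -> R),
    [/\ nbhs x U, rotation Q, j.+1 = d, open V & C11_on V phi] /\
    [set v *m Q | v in boundary A `&` U] = graph_on j V phi.

Definition msupport (R : realType) d (nu : set 'rV[R]_d -> \bar R) :
    set 'rV[R]_d :=
  [set x | forall U, open U -> U x -> (0 < nu U)%E].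

Definition has_density (R : realType) d (nu : set 'rV[R]_d -> \bar R)
    (f : 'rV[R]_d -> R) : Prop :=
  [/\ (forall x, 0 <= f x), measurable_fun setT f &
      forall B, measurable B ->
        nu B = (\int[@lebesgue_rV R d]_(x in B) (f x)%:E)%E].

Section independence.
Context dO (Omega : measurableType dO) (R : realType) (P : probability Omega R).

Definition mutually_independent d (T : measurableType d)
    (X : nat -> Omega -> T) : Prop :=
  forall (J : {fset nat}) (B : nat -> set T), (forall i, measurable (B i)) ->
    P (\bigcap_(i in [set` J]) X i @^-1` B i) =
    (\prod_(i <- J) P (X i @^-1` B i))%E.

Definition sigma_family d (T : measurableType d) (X : nat -> Omega -> T) :
    set_system Omega :=
  <<s \bigcup_i preimage_set_system setT (X i) measurable >>.

Definition independent_of_family d (T : measurableType d) d' (T' : measurableType d')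
    (Z : Omega -> T') (X : nat -> Omega -> T) : Prop :=
  forall C E, measurable C -> sigma_family X E ->
    P (Z @^-1` C `&` E) = (P (Z @^-1` C) * P E)%E.

End independence.

Section geometric_graph.
Context {R : realType} {d : nat}.

Definition adjacent (r : R) (S : {fset 'rV[R]_d}) : rel S :=
  fun x y => (x != y) && (enorm (val x - val y) <= r).

Definition components (r : R) (S : {fset 'rV[R]_d}) : {set {set S}} :=
  [set [set y | connect (adjacent r (S := S)) x y] | x : S]%SET.

Definition component_count (k : nat) (r : R) (S : {fset 'rV[R]_d}) : nat :=
  #|[set C in components r S | #|C| == k]%SET|.

End geometric_graph.

(* X_1, ..., X_n is represented by X 0, ..., X (n - 1). *)
Definition first_points (T : choiceType) (Omega : Type) (X : nat -> Omega -> T)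
    (n : nat) (w : Omega) : {fset T} :=
  [fset X i w | i in iota 0 n]%fset.

Section counts.
Context (d : nat) dO (Omega : measurableType dO) (R : realType) (P : probability Omega R).
Variables (X : nat -> Omega -> 'rV[R]_d) (Z : nat -> Omega -> nat) (r : nat -> R).

(* The number of k-vertex components on the first n points (S_{n,k}), on the
   first Z_n points (S'_{n,k}), and the mean of the latter (I_{n,k}). *)
Definition count_binomial (n k : nat) (w : Omega) : R :=
  (component_count k (r n) (first_points X n w))%:R.

Definition count_poisson (n k : nat) (w : Omega) : R :=
  (component_count k (r n) (first_points X (Z n w) w))%:R.

Definition mean_count_poisson (n k : nat) : \bar R := 'E_P[count_poisson n k]%E.

End counts.

(* Main.v *)
(* Fix k points y, let h(y) be the indicator that they are connected at scale r
   and q(y) the nu-mass of the points at distance > r from all of them. Summing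
   over the k-subsets of the indices that form a component,
     E[K_k(X_1, ..., X_m)] = C(m, k) * \int h q^(m - k) d nu^k,
   and averaging over a Poisson number m of points of mean n gives
     E[K_k(P_n)] = \int h (n^k / k!) exp (- n (1 - q)) d nu^k.
   Since f is bounded by some M on the compact support, 1 - q <= k M (2 r)^d, so
   with u = n r^d the two integrands at m = n agree up to a factor
   1 + O((1 + u + u^2) / n), uniformly in y. The upper bound on r gives
   u = O(log n), hence the error is O(exp (- c u)) for small c. *)
Require Import Defs.
From HB Require Import structures.
From mathcomp Require Import all_boot all_order all_algebra finmap.
From mathcomp Require Import all_classical all_reals all_analysis.
From mathcomp Require Import measurable_realfun ring lra.

Set Implicit Arguments.
Unset Strict Implicit.
Unset Printing Implicit Defensive.

Import Order.TTheory GRing.Theory Num.Theory.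
Import numFieldNormedType.Exports.

Local Open Scope classical_set_scope.
Local Open Scope ring_scope.

(** * Components of finite graphs *)

(** The error is relative to [I_{n,k}], and the factor exp (- n (1 - q)) varies widely with y. The
    two integrands are therefore compared for each y by a factor close to 1: such a comparison
    survives integration whatever the size of the mean. With p = 1 - q = O(u / n), the error has
    three sources: C(n, k) against n^k / k! costs k^2 / n, (1 - p)^n against exp (- n p) costs n
    p^2, and the exponent n - k in place of n costs a multiple of k p. Since 2 c u <= log n
    eventually, 1 / n <= exp (- 2 c u); half of this exponent absorbs 1 + u + u^2 and the other half
    is the rate. Vertices are points, and equal points would merge, whereas probabilities are
    computed on indices. The two counts agree off the null event of coincident points, because [nu]
    has no atoms. *)

Section graph_components.
Variables (I : finType) (e : rel I).

(** [components] for an arbitrary vertex type, so that the vertices can be the fixed indices ['I_n]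
    instead of a random set of points. *)
Definition comps : {set {set I}} := [set [set y | connect e x y] | x : I]%SET.

Lemma comps_closed (C : {set I}) (x y : I) :
  C \in comps -> e x y -> x \in C -> y \in C.
Proof.
move=> /imsetP[z _ ->] exy; rewrite !inE => zx.
exact: connect_trans zx (connect1 exy).
Qed.

End graph_components.

Lemma homo_connect (I J : finType) (f : I -> J) (e : rel I) (e' : rel J) :
  (forall x y, e x y -> e' (f x) (f y)) ->
  forall x y, connect e x y -> connect e' (f x) (f y).
Proof.
move=> ee' x y /connectP[p]; elim: p x => [|z p IH] x /=.
  by move=> _ ->; exact: connect0.
move=> /andP[xz zp] yE.
exact: connect_trans (connect1 (ee' _ _ xz)) (IH _ zp yE).
Qed.

Lemma comps_bij (I J : finType) (f : I -> J) (e : rel I) (e' : rel J) :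
  bijective f -> (forall x y, e' (f x) (f y) = e x y) ->
  forall k, (#|[set C in comps e' | #|C| == k]| =
             #|[set C in comps e | #|C| == k]|)%SET.
Proof.
move=> [g fK gK] ee' k.
have fI := can_inj fK.
have conn x y : connect e' (f x) (f y) = connect e x y.
  apply/idP/idP; last by apply: homo_connect => ? ?; rewrite ee'.
  rewrite -{2}(fK x) -{2}(fK y).
  by apply: homo_connect => a b; rewrite -{1}(gK a) -{1}(gK b) ee'.
have imE x : ([set y | connect e' (f x) y] = f @: [set y | connect e x y])%SET.
  by apply/setP => y; rewrite inE -(gK y) conn mem_imset// inE.
have -> : ([set C in comps e' | #|C| == k] =
    [set f @: (D : {set I}) | D in [set C in comps e | #|C| == k]])%SET.
  apply/setP => C; apply/idP/imsetP.
    rewrite inE => /andP[/imsetP[y _ ->]].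
    rewrite -(gK y) imE card_imset// => Ck.
    by eexists; last reflexivity; rewrite inE Ck andbT imset_f.
  move=> [D]; rewrite !inE => /andP[/imsetP[x _ ->] Ck] ->.
  by rewrite card_imset// Ck -imE imset_f.
by rewrite card_imset//; exact: imset_inj.
Qed.

(* [s] enumerates [C] and [t] its complement, so that the first conjunct only
   involves the points of [C]. *)
Lemma mem_compsE (I : finType) (e : rel I) (k l : nat) (C : {set I})
    (s : 'I_k -> I) (t : 'I_l -> I) :
  (0 < k)%N -> symmetric e -> injective s ->
  C =i codom s -> (forall x, (x \notin C) = (x \in codom t)) ->
  (C \in comps e) = [forall i, forall j, connect (relpre s e) i j] &&
                    [forall i, forall j, ~~ e (s i) (t j)].
Proof.
move=> k0 esym sI Cs Ct.
have sC i : s i \in C by rewrite Cs codom_f.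
have tC i : t i \notin C by rewrite Ct codom_f.
apply/idP/andP => [Ce|[/'forall_forallP conn /'forall_forallP sep]].
  split; apply/forallP => i; apply/forallP => j; last first.
    by apply/negP => /(comps_closed Ce)/(_ (sC i)); exact/negP.
  have : connect e (s i) (s j).
    case/imsetP: (Ce) => x _ CE; have := sC i; have := sC j.
    rewrite CE !inE => xj xi; apply: connect_trans xj.
    by rewrite (sym_connect_sym esym).
  (* A path that starts in [C] never leaves it, so its vertices are values of [s] and the path lifts
     to the indices ['I_k]. *)
  move=> /connectP[p]; elim: p i => [|z p IH] i /=.
    by move=> _ /sI ->; exact: connect0.
  move=> /andP[iz zp] jE.
  have : z \in C by exact: comps_closed Ce iz (sC i).
  rewrite Cs => /codomP[i' zE]; rewrite zE in iz zp jE.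
  exact: connect_trans (connect1 iz) (IH _ zp jE).
(* Since [k > 0], [C] has a vertex [s] at index 0; [C] is connected and has no edge to its
   complement, so it is the class of that vertex. *)
have CE : (C = [set y | connect e (s (Ordinal k0)) y])%SET.
  apply/setP => y; rewrite inE; apply/idP/idP.
    rewrite Cs => /codomP[j ->]; apply: homo_connect (conn _ _).
    by move=> a b.
  move=> /(@closed_connect _ e (mem C)) <- //.
  move=> a b eab; apply/idP/idP.
    apply: contraTT; rewrite Ct => /codomP[j bE]; apply/negP.
    rewrite Cs => /codomP[i aE].
    by have := sep i j; rewrite -aE -bE eab.
  apply: contraTT; rewrite Ct => /codomP[j bE]; apply/negP.
  rewrite Cs => /codomP[i aE].
  by have := sep i j; rewrite -aE -bE esym eab.
by rewrite CE imset_f.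
Qed.

Definition adj (R : realType) (d : nat) (I : eqType) (r : R) (x : I -> 'rV[R]_d)
  : rel I := fun i j => (i != j) && (enorm (x i - x j) <= r).

Lemma enormN (R : realType) d (v : 'rV[R]_d) : enorm (- v) = enorm v.
Proof.
by rewrite /enorm; congr Num.sqrt; apply: eq_bigr => i _; rewrite mxE sqrrN.
Qed.

Lemma enorm_le0 (R : realType) d (v : 'rV[R]_d) : (enorm v <= 0) = (v == 0).
Proof.
apply/idP/eqP => [|->]; last first.
  by rewrite /enorm big1 ?sqrtr0// => i _; rewrite mxE expr0n.
move=> n0; have : enorm v == 0 by rewrite eq_le n0 sqrtr_ge0.
rewrite sqrtr_eq0 => le0; have : \sum_(i < d) v ord0 i ^+ 2 == 0.
  by rewrite eq_le le0 sumr_ge0// => i _; exact: sqr_ge0.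
rewrite psumr_eq0 => [/allP v0|i _]; last exact: sqr_ge0.
by apply/rowP => i; have := v0 i (mem_index_enum i); rewrite mxE sqrf_eq0 => /eqP.
Qed.

Lemma adj_sym (R : realType) (d : nat) (I : eqType) (r : R) (x : I -> 'rV[R]_d) :
  symmetric (adj r x).
Proof. by move=> i j; rewrite /adj eq_sym -opprB enormN. Qed.

(** Equal points would merge in the finite set on the left but stay distinct vertices on the right,
    hence the injectivity. *)
Lemma component_count_image (R : realType) (d : nat) (r : R)
    (x : nat -> 'rV[R]_d) (n k : nat) :
  (forall i j, (i < n)%N -> (j < n)%N -> x i = x j -> i = j) ->
  component_count k r [fset x i | i in iota 0 n]%fset =
  #|[set C in comps (adj r (fun i : 'I_n => x i)) | #|C| == k]%SET|.
Proof.
move=> xI; set S := [fset x i | i in iota 0 n]%fset.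
have xS (i : 'I_n) : x i \in S by apply/imfsetP; exists (val i) => //=; rewrite mem_iota add0n /=.
pose f (i : 'I_n) : S := [` xS i]%fset.
have fI : injective f by move=> i j /(congr1 val) /= /xI ij; exact/val_inj/ij.
have [g gK] : exists g, cancel g f.
  have fS (s : S) : exists i, f i == s.
    have /imfsetP[i /= + sE] := valP s; rewrite mem_iota add0n /= => ni.
    by exists (Ordinal ni); apply/eqP/val_inj.
  by exists (fun s => xchoose (fS s)) => s; exact/eqP/(xchooseP (fS s)).
apply: (@comps_bij _ _ f).
  by exists g => // i; apply: fI; rewrite gK.
by move=> i j; rewrite /adj -(inj_eq fI).
Qed.

(** * Joint laws of independent identically distributed points *)

Definition rV_box (T : Type) (n : nat) (B : 'I_n -> set T) : set 'rV[T]_n :=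
  [set v | forall i, B i (v ord0 i)].

Lemma measurable_rV_box d (T : measurableType d) n (B : 'I_n -> set T) :
  (forall i, measurable (B i)) -> measurable (rV_box B).
Proof.
move=> mB.
have -> : rV_box B =
    \bigcap_(i in [set` enum 'I_n]) (fun v : 'rV[T]_n => v ord0 i) @^-1` B i.
  apply/seteqP; split => v vB i => [_|]; first exact: vB.
  by apply: vB; rewrite /= mem_enum.
apply: fin_bigcap_measurable => // i _.
by rewrite -[X in measurable X]setTI; exact: measurable_coord.
Qed.

(** Boxes are stable under intersection and include the coordinate cylinders, which generate the
    product sigma-algebra, so a pi-system argument applies. *)
Lemma rV_measure_unique d (T : measurableType d) (R : realType) n
    (m1 m2 : {measure set 'rV[T]_n -> \bar R}) :
  (m1 setT < +oo)%E ->
  (forall B : 'I_n -> set T, (forall i, measurable (B i)) ->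
     m1 (rV_box B) = m2 (rV_box B)) ->
  forall E, measurable E -> m1 E = m2 E.
Proof.
move=> m1oo m12 E mE.
pose G := [set D | exists2 B : 'I_n -> set T,
  (forall i, measurable (B i)) & D = rV_box B].
have GT : G setT.
  exists (fun=> setT) => //.
  by apply/seteqP; split.
apply: (g_sigma_algebra_measure_unique G _ (fun=> setT)) => //.
- by move=> D [B mB ->]; exact: measurable_rV_box.
- by rewrite bigcup_const.
- move=> _ _ [B mB ->] [C mC ->]; exists (fun i => B i `&` C i).
    by move=> i; exact: measurableI.
  by apply/seteqP; split => [v [vB vC] i|v vBC]; [split|split=> i; case: (vBC i)].
- by move=> _ [B mB ->]; exact: m12.
- move: E mE; apply: smallest_sub; first exact: smallest_sigma_algebra.
  move=> D; rewrite -bigcup_seq => -[i _ [C mC <-]].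
  apply: sub_sigma_algebra; exists (fun j => if j == i then C else setT).
    by move=> j; case: ifP.
  rewrite setTI; apply/seteqP; split => [v vC j|v /(_ i)]; last by rewrite eqxx.
  by case: ifPn => // /eqP ->.
Qed.

Section iid_vectors.
Context dO (Omega : measurableType dO) (R : realType) (P : probability Omega R).
Context dT (T : measurableType dT).
Variables (X : nat -> {RV P >-> T}) (nu : probability T R).
Hypothesis X_law : forall i B, measurable B -> distribution P (X i) B = nu B.
Hypothesis X_indep : mutually_independent P X.

Lemma iid_prob_inj (I : finType) (s : I -> nat) (B : I -> set T) :
  injective s -> (forall i, measurable (B i)) ->
  P [set w | forall i, B i (X (s i) w)] = (\prod_i nu (B i))%E.
Proof.
move=> sI mB.
(* [mutually_independent] wants a set for every natural number: [B] is transported along the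
   injective [s], and the other indices get the whole space. *)
pose B' j := if [pick i | s i == j] is Some i then B i else setT.
have B's i : B' (s i) = B i.
  rewrite /B'; case: pickP => [j /eqP/sI -> //|/(_ i)]; by rewrite eqxx.
have mB' j : measurable (B' j) by rewrite /B'; case: pickP.
transitivity (P (\bigcap_(j in [set` [fset s i | i in I]%fset])
    X j @^-1` B' j)).
  congr (P _); apply/seteqP; split => [w wB _ /= /imfsetP[i _ ->]|w wB i].
    by rewrite B's; exact: wB.
  by rewrite -B's; apply: wB => /=; apply/imfsetP; exists i.
rewrite X_indep// big_imfset => /=; last by move=> i j _ _; exact: sI.
by rewrite big_enum/=; apply: eq_bigr => i _; rewrite B's; exact: X_law.
Qed.

Definition points (k : nat) (s : 'I_k -> nat) (w : Omega) : 'rV[T]_k :=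
  \row_i X (s i) w.

Lemma measurable_points k (s : 'I_k -> nat) : measurable_fun setT (points s).
Proof.
apply: measurable_fun_rVP => i; under eq_fun do rewrite mxE.
exact: measurable_funPT.
Qed.

HB.instance Definition _ k (s : 'I_k -> nat) :=
  isMeasurableFun.Build _ _ _ _ (points s) (measurable_points s).

(** The [k]-fold power of [nu], obtained as the law of the first [k] points rather than as an
    iterated product; [points_law_box] justifies this. *)
Definition points_law (k : nat) : probability 'rV[T]_k R :=
  distribution P (points (@nat_of_ord k)).

Lemma points_law_box k (B : 'I_k -> set T) : (forall i, measurable (B i)) ->
  points_law k (rV_box B) = (\prod_i nu (B i))%E.
Proof.
move=> mB; rewrite -(iid_prob_inj (@ord_inj k) mB).
by congr (P _); apply/seteqP; split => w + i => /(_ i); rewrite mxE.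
Qed.

(** Independence gives the concatenated vector the same mass on boxes as the product of the two
    laws, so both agree, and the product measure is an integral over sections. [join] and [cut] pass
    between pairs and vectors of length [k + l], where [rV_measure_unique] applies. *)
Lemma joint_points_law k l (s : 'I_k -> nat) (t : 'I_l -> nat)
    (E : set ('rV[T]_k * 'rV[T]_l)) :
  injective s -> injective t -> (forall i j, s i != t j) -> measurable E ->
  P [set w | E (points s w, points t w)] =
  (\int[points_law k]_y points_law l (xsection E y))%E.
Proof.
move=> sI tI st mE.
pose u (i : 'I_(k + l)) := match fintype.split i with inl i => s i | inr j => t j end.
have ul i : u (lshift l i) = s i by rewrite /u (unsplitK (inl i)).
have ur i : u (rshift k i) = t i by rewrite /u (unsplitK (inr i)).
have uI : injective u.
  move=> i j; rewrite -(splitK i) -(splitK j).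
  case: (fintype.split i) => i'; case: (fintype.split j) => j' /=; rewrite ?ul ?ur.
  - by move=> /sI ->.
  - by move=> sitj; have := st i' j'; rewrite sitj eqxx.
  - by move=> sitj; have := st j' i'; rewrite sitj eqxx.
  - by move=> /tI ->.
pose join (p : 'rV[T]_k * 'rV[T]_l) : 'rV[T]_(k + l) := row_mx p.1 p.2.
have mjoin : measurable_fun setT join.
  apply: measurable_fun_rVP => i; rewrite /join -(splitK i).
  case: (fintype.split i) => j /=.
    under eq_fun do rewrite row_mxEl.
    exact: (measurableT_comp (measurable_coord j)).
  under eq_fun do rewrite row_mxEr.
  exact: (measurableT_comp (measurable_coord j)).
pose joinM : {mfun ('rV[T]_k * 'rV[T]_l)%type >-> 'rV[T]_(k + l)} :=
  HB.pack join (isMeasurableFun.Build _ _ _ _ join mjoin).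
pose cut (v : 'rV[T]_(k + l)) : 'rV[T]_k * 'rV[T]_l := (lsubmx v, rsubmx v).
have mcut : measurable_fun setT cut.
  apply/measurable_fun_pair; apply: measurable_fun_rVP => i;
    under eq_fun do rewrite mxE; exact: measurable_coord.
have joinK p : cut (join p) = p.
  by case: p => y z; rewrite /cut /join row_mxKl row_mxKr.
pose m2 := pushforward (points_law k \x points_law l)%E joinM.
have m12 : forall D, measurable D -> distribution P (points u) D = m2 D.
  apply: rV_measure_unique.
    exact: le_lt_trans (probability_le1 _ measurableT) (ltry _).
  move=> B mB.
  transitivity (\prod_i nu (B i))%E.
    rewrite -(iid_prob_inj uI mB).
    by congr (P _); apply/seteqP; split => w + i => /(_ i); rewrite mxE.
  transitivity ((points_law k \x points_law l)%E (join @^-1` rV_box B)) => //.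
  have -> : join @^-1` rV_box B =
    rV_box (fun i => B (lshift l i)) `*` rV_box (fun j => B (rshift k j)).
    apply/seteqP; split => [[y z] /= yzB|[y z] /= [yB zB] i].
      split => i; first by have := yzB (lshift l i); rewrite row_mxEl.
      by have := yzB (rshift k i); rewrite row_mxEr.
    rewrite -(splitK i); case: (fintype.split i) => j /=; rewrite ?row_mxEl ?row_mxEr.
      exact: yB.
    exact: zB.
  rewrite product_measure1E//; [|exact: measurable_rV_box..].
  by rewrite big_split_ord; congr *%E; apply/esym/points_law_box.
have mcE : measurable (cut @^-1` E).
  by rewrite -[X in measurable X]setTI; exact: mcut.
transitivity (distribution P (points u) (cut @^-1` E)).
  congr (P _); apply/seteqP; split => w /=;
  rewrite (_ : cut _ = (points s w, points t w))//; congr pair;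
    by apply/rowP => i; rewrite !mxE ?ul ?ur.
rewrite m12// /m2 /pushforward.
by rewrite -comp_preimage (_ : cut \o join = id)//; apply/funext.
Qed.

End iid_vectors.

(** * Integrals off null sets and measurability of graph events *)

(** The integral of a nonnegative function is a supremum over the simple functions below it, so
    monotonicity extends to non-measurable functions. *)
Lemma ge0_integral_monotone d (T : measurableType d) (R : realType)
    (mu : {measure set T -> \bar R}) (f g : T -> \bar R) :
  (forall x, 0 <= f x)%E -> (forall x, f x <= g x)%E ->
  (\int[mu]_x f x <= \int[mu]_x g x)%E.
Proof.
move=> f0 fg; rewrite !ge0_integralTE//; last first.
  by move=> x; exact: le_trans (f0 x) (fg x).
by apply: le_ereal_sup => _ [h hf <-]; exists h => // x; exact: le_trans (hf x) (fg x).
Qed.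

(* [f] is not assumed measurable: the component counts are only identified with
   a measurable function off the null set where two of the points coincide. *)
Lemma ge0_integral_eq_off_null d (T : measurableType d) (R : realType)
    (mu : {measure set T -> \bar R}) (N : set T) (f g : T -> \bar R) :
  measurable N -> mu N = 0%E -> measurable_fun setT g ->
  (forall x, 0 <= f x)%E -> (forall x, ~ N x -> f x = g x) ->
  (\int[mu]_x f x = \int[mu]_x g x)%E.
Proof.
move=> mN N0 mg f0 fg.
(* Replacing [g] by a constant [c] on [N] keeps it measurable and keeps its integral; [c = +oo] and
   [c = 0] enclose [f] whatever its values on [N]. *)
pose h c x := if x \in N then c else g x.
have hE c : (\int[mu]_x h c x = \int[mu]_x g x)%E.
  apply: ae_eq_integral => //.
    apply: measurable_fun_if => //.
    - apply: (measurable_fun_bool true) => //.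
      by rewrite setTI (_ : _ @^-1` _ = N)//; apply/seteqP; split => [x /set_mem//|x xN]; last exact: (mem_set xN).
    - exact: measurable_funS mg.
  exists N; split => // x; rewrite /h /=; apply: contra_notP => xN _.
  by case: ifPn => //; rewrite inE.
apply/eqP; rewrite eq_le -{1}(hE +oo%E) -(hE 0%E); apply/andP; split.
  apply: ge0_integral_monotone => // x; rewrite /h; case: ifPn => [_|].
    exact: leey.
  by move=> xN; rewrite fg//; rewrite notin_setE in xN.
apply: ge0_integral_monotone => x; rewrite /h; case: ifPn => // xN;
  by rewrite -fg//; rewrite notin_setE in xN.
Qed.

Lemma measurable_enormB d (T : measurableType d) (R : realType) n
    (f g : T -> 'rV[R]_n) :
  measurable_fun setT f -> measurable_fun setT g ->
  measurable_fun setT (fun x => enorm (f x - g x)).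
Proof.
move=> mf mg; rewrite /enorm.
have msqrt : measurable_fun setT (@Num.sqrt R).
  exact: continuous_measurable_fun (@sqrt_continuous R).
apply: (measurableT_comp msqrt).
apply: measurable_sum => i; apply: measurable_funX.
under eq_fun do rewrite !mxE.
apply: measurable_funB.
  exact: (measurableT_comp (measurable_coord i)).
exact: (measurableT_comp (measurable_coord i)).
Qed.

Lemma measurable_near d (T : measurableType d) (R : realType) n r
    (f g : T -> 'rV[R]_n) :
  measurable_fun setT f -> measurable_fun setT g ->
  measurable [set x | enorm (f x - g x) <= r].
Proof.
move=> mf mg; rewrite -[X in measurable X]setTI.
by apply: measurable_fun_ler => //; exact: measurable_enormB.
Qed.

(** A graph property depends only on which pairs are close. There are finitely many such patterns,
    so the event is a finite union of finite intersections. *)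
Lemma measurable_finite_config d (T : measurableType d) (I : finType)
    (b : I -> T -> bool) (F : {ffun I -> bool} -> bool) :
  (forall i, measurable [set x | b i x]) ->
  measurable [set x | F [ffun i => b i x]].
Proof.
move=> mb.
have -> : [set x | F [ffun i => b i x]] =
    \bigcup_(c in [set` [pred c | F c]])
      \bigcap_(i in [set` enum I]) [set x | b i x = c i].
  apply/seteqP; split => [x Fx|x [c Fc xc]].
    by exists [ffun i => b i x] => // i _; rewrite /= ffunE.
  rewrite /= (_ : [ffun i => b i x] = c)//; apply/ffunP => i; rewrite ffunE.
  by apply: xc; rewrite /= mem_enum.
apply: fin_bigcup_measurable => [|c _]; first exact: finite_finset.
apply: fin_bigcap_measurable => // i _.
case: (c i); first exact: mb.
rewrite (_ : [set x | _] = ~` [set x | b i x]); first exact: measurableC.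
by apply/seteqP; split => [x /= ->//|x /= /negP/negbTE].
Qed.

Definition conn (R : realType) d k (r : R) (y : 'I_k -> 'rV[R]_d) : bool :=
  [forall i, forall j, connect (adj r y) i j].

Definition far (R : realType) d k l (r : R) (y : 'I_k -> 'rV[R]_d)
    (z : 'I_l -> 'rV[R]_d) : bool :=
  [forall i, forall j, ~~ (enorm (y i - z j) <= r)].

Lemma measurable_conn d (T : measurableType d) (R : realType) n k (r : R)
    (y : T -> 'I_k -> 'rV[R]_n) :
  (forall i, measurable_fun setT (y ^~ i)) -> measurable [set x | conn r (y x)].
Proof.
move=> my.
pose F (c : {ffun 'I_k * 'I_k -> bool}) := [forall i, forall j,
  connect (fun i j => (i != j) && c (i, j)) i j].
pose b (p : 'I_k * 'I_k) x := enorm (y x p.1 - y x p.2) <= r.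
have := @measurable_finite_config _ T _ b F.
rewrite (_ : [set x | _] = [set x | conn r (y x)]).
  by apply=> p; exact: measurable_near.
apply: eq_set => x; congr is_true.
apply: eq_forallb => i; apply: eq_forallb => j; apply: eq_connect => {}i {}j.
by rewrite ffunE.
Qed.

Lemma measurable_far d (T : measurableType d) (R : realType) n k l (r : R)
    (y : T -> 'I_k -> 'rV[R]_n) (z : T -> 'I_l -> 'rV[R]_n) :
  (forall i, measurable_fun setT (y ^~ i)) ->
  (forall i, measurable_fun setT (z ^~ i)) ->
  measurable [set x | far r (y x) (z x)].
Proof.
move=> my mz.
pose F (c : {ffun 'I_k * 'I_l -> bool}) := [forall i, forall j, ~~ c (i, j)].
pose b (p : 'I_k * 'I_l) x := enorm (y x p.1 - z x p.2) <= r.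
have := @measurable_finite_config _ T _ b F.
rewrite (_ : [set x | _] = [set x | far r (y x) (z x)]).
  by apply=> p; exact: measurable_near.
apply: eq_set => x; congr is_true.
by apply: eq_forallb => i; apply: eq_forallb => j; rewrite ffunE.
Qed.

(** * The probability that given points form a component *)

Lemma eq_comps (I : finType) (e e' : rel I) : e =2 e' -> comps e = comps e'.
Proof.
move=> ee'; rewrite /comps; apply: eq_imset => x; apply/setP => y.
by rewrite !inE (eq_connect ee').
Qed.

Lemma measurable_mem_comps d (T : measurableType d) (R : realType) n (I : finType)
    (r : R) (x : T -> I -> 'rV[R]_n) (C : {set I}) :
  (forall i, measurable_fun setT (x ^~ i)) ->
  measurable [set w | C \in comps (adj r (x w))].
Proof.
move=> mx.
pose F (c : {ffun I * I -> bool}) :=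
  C \in comps (fun i j => (i != j) && c (i, j)).
pose b (p : I * I) w := enorm (x w p.1 - x w p.2) <= r.
have := @measurable_finite_config _ T _ b F.
rewrite (_ : [set w | _] = [set w | C \in comps (adj r (x w))]).
  by apply=> p; exact: measurable_near.
apply: eq_set => w; congr is_true; rewrite /F.
by rewrite (@eq_comps _ _ (adj r (x w)))// => i j; rewrite ffunE.
Qed.

Lemma set_enumeration (n k : nat) (C : {set 'I_n}) : #|C| = k ->
  exists2 s : 'I_k -> 'I_n, injective s & C =i codom s.
Proof.
move=> Ck; exists (fun i => enum_val (cast_ord (esym Ck) i)).
  by move=> i j /enum_val_inj/cast_ord_inj.
move=> x; apply/idP/codomP => [xC|[i ->]]; last exact: enum_valP.
exists (cast_ord Ck (enum_rank_in xC x)).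
by rewrite cast_ordK enum_rankK_in.
Qed.

Section component_probability.
Context dO (Omega : measurableType dO) (R : realType) (P : probability Omega R).
Context (d : nat).
Variables (X : nat -> {RV P >-> 'rV[R]_d}) (nu : probability 'rV[R]_d R).
Hypothesis X_law : forall i B, measurable B -> distribution P (X i) B = nu B.
Hypothesis X_indep : mutually_independent P X.

Definition far_set k (r : R) (y : 'rV['rV[R]_d]_k) : set 'rV[R]_d :=
  [set z | far r (y ord0) (fun _ : 'I_1 => z)].

Lemma measurable_far_set k (r : R) (y : 'rV['rV[R]_d]_k) :
  measurable (far_set r y).
Proof. exact: measurable_far. Qed.

Definition avoid_prob k (r : R) (y : 'rV['rV[R]_d]_k) : R :=
  fine (nu (far_set r y)).

Lemma avoid_probE k (r : R) (y : 'rV['rV[R]_d]_k) :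
  (avoid_prob r y)%:E = nu (far_set r y).
Proof. by rewrite fineK// fin_num_measure//; exact: measurable_far_set. Qed.

Lemma avoid_prob_ge0 k (r : R) (y : 'rV['rV[R]_d]_k) : 0 <= avoid_prob r y.
Proof. exact: fine_ge0. Qed.

Lemma avoid_prob_le1 k (r : R) (y : 'rV['rV[R]_d]_k) : avoid_prob r y <= 1.
Proof. by rewrite -lee_fin avoid_probE probability_le1//; exact: measurable_far_set. Qed.

(** [far_set r y] is the section at [y] of a single measurable set of pairs. *)
Lemma measurable_avoid_prob k (r : R) :
  measurable_fun setT (@avoid_prob k r).
Proof.
pose E := [set p : 'rV['rV[R]_d]_k * 'rV[R]_d |
  far r (p.1 ord0) (fun _ : 'I_1 => p.2)].
have mE : measurable E.
  apply: measurable_far => i; last exact: measurable_snd.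
  exact: (measurableT_comp (measurable_coord i)).
apply: (measurableT_comp (f := fine)) => //.
rewrite (_ : (fun _ => _) = nu \o xsection E); last first.
  by apply/funext => y /=; congr (nu _); rewrite xsectionE.
exact: measurable_fun_xsection.
Qed.

(** Given [y], the probability that it is connected and that [m] further points all avoid it; [m]
    excludes the points of [y]. *)
Definition cluster_density k (r : R) (m : nat) (y : 'rV['rV[R]_d]_k) : R :=
  (conn r (y ord0))%:R * avoid_prob r y ^+ m.

Lemma cluster_density_ge0 k (r : R) m (y : 'rV['rV[R]_d]_k) :
  0 <= cluster_density r m y.
Proof. by rewrite mulr_ge0// exprn_ge0// avoid_prob_ge0. Qed.

(** By [mem_compsE] the event splits into a condition on the points of [C] and the absence of edges
    to the others. Given the former points, the [n - k] others avoid them independently, which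
    yields the power of [avoid_prob]. *)
Lemma prob_component k (r : R) n (C : {set 'I_n}) : (0 < k)%N -> #|C| = k ->
  P [set w | C \in comps (adj r (fun i : 'I_n => X i w))] =
  (\int[points_law X k]_y (cluster_density r (n - k) y)%:E)%E.
Proof.
move=> k0 Ck; have [s sI Cs] := set_enumeration Ck.
have Ck' : #|~: C| = (n - k)%N.
  by have /(congr1 (subn^~ k)) := cardsC C; rewrite card_ord Ck addKn.
have [t tI Ct] := set_enumeration Ck'.
have st i j : s i != t j.
  have := codom_f t j; rewrite -Ct inE; apply: contraNneq => <-.
  by rewrite Cs codom_f.
pose W := ('rV['rV[R]_d]_k * 'rV['rV[R]_d]_(n - k))%type.
pose E := [set p : W |
  conn r (p.1 ord0) && far r (p.1 ord0) (p.2 ord0)].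
have mE : measurable E.
  rewrite (_ : E = [set p : W | conn r (p.1 ord0)] `&`
      [set p : W | far r (p.1 ord0) (p.2 ord0)]); last first.
    by apply/seteqP; split => p; rewrite /E /= => /andP.
  apply: measurableI.
    apply: measurable_conn => i.
    exact: (measurableT_comp (measurable_coord i)).
  by apply: measurable_far => i; exact: (measurableT_comp (measurable_coord i)).
transitivity (P [set w | E (points X s w, points X t w)]).
  congr (P _); apply: eq_set => w; congr is_true => /=.
  rewrite (mem_compsE (t := t) k0 (adj_sym _ _) sI Cs); last first.
    by move=> x; rewrite -Ct inE.
  apply: (congr2 andb); apply: eq_forallb => i; apply: eq_forallb => j.
    by apply: eq_connect => {}i {}j; rewrite /adj /= (inj_eq sI) !mxE.
  by rewrite /adj st !mxE.
rewrite (joint_points_law X_law X_indep) //; last 2 first.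
- by move=> i j /val_inj/sI.
- by move=> i j /val_inj/tI.
apply: eq_integral => y _; rewrite /cluster_density.
have [cy|cy] := boolP (conn r (y ord0)); last first.
  rewrite mul0r (_ : xsection E y = set0) ?measure0//.
  by apply/seteqP; split => z //; rewrite xsectionE /E /= (negbTE cy).
rewrite mul1r (_ : xsection E y = rV_box (fun _ => far_set r y)); last first.
  rewrite xsectionE /E; apply/seteqP; split => z /=; rewrite cy /=.
    move=> /'forall_forallP yz j; apply/'forall_forallP => i i'.
    exact: yz.
  move=> yz; apply/'forall_forallP => i j.
  by have /'forall_forallP/(_ i ord0) := yz j.
rewrite (points_law_box X_law X_indep); last by move=> _; exact: measurable_far_set.
by rewrite -avoid_probE prodEFin prodr_const card_ord.
Qed.

Hypothesis nu_atomless : forall x, nu [set x] = 0%E.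

Lemma prob_coincide i j : i != j -> P [set w | X i w = X j w] = 0%E.
Proof.
move=> ij.
(* Coincidence is written as distance at most 0 to be measurable; given the first point, the second
   must hit a singleton. *)
pose E := [set p : 'rV['rV[R]_d]_1 * 'rV['rV[R]_d]_1 |
  enorm (p.1 ord0 ord0 - p.2 ord0 ord0) <= 0].
have mE : measurable E.
  by apply: measurable_near; exact: (measurableT_comp (measurable_coord ord0)).
transitivity (P [set w |
    E (points X (fun _ : 'I_1 => i) w, points X (fun _ : 'I_1 => j) w)]).
  congr (P _); apply/seteqP; split => w; rewrite /E /= !mxE enorm_le0 subr_eq0.
    by move=> ->.
  by move=> /eqP.
rewrite (joint_points_law X_law X_indep) //; last 2 first.
- by move=> a b _; rewrite !ord1.
- by move=> a b _; rewrite !ord1.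
apply: integral0_eq => y _.
rewrite (_ : xsection E y = rV_box (fun _ => [set y ord0 ord0])); last first.
  rewrite xsectionE; apply/seteqP; split => z; rewrite /E /= enorm_le0 subr_eq0.
    by move=> /eqP yz a /=; rewrite yz; congr (z _ _); rewrite !ord1.
  by move=> /(_ ord0) /= ->.
rewrite (points_law_box X_law X_indep); last first.
  move=> _; rewrite (_ : [set _] = [set z | enorm (y ord0 ord0 - z) <= 0]).
    exact: measurable_near.
  apply/seteqP; split => z /=; rewrite enorm_le0 subr_eq0; first by move=> ->.
  by move=> /eqP ->.
by rewrite big_ord1.
Qed.

(** A single null set serves all pairs of indices, as the Poisson sample size is unbounded. *)
Lemma coincidence_null : exists N, [/\ measurable N, P N = 0%E &
  forall w, ~ N w -> injective (X ^~ w)].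
Proof.
pose N i j := if i == j then set0 else [set w | X i w = X j w].
have mN i j : measurable (N i j).
  rewrite /N; case: ifP => // _.
  rewrite (_ : [set w | _] = [set w | enorm (X i w - X j w) <= 0]).
    by apply: measurable_near; exact: measurable_funPT.
  by apply/seteqP; split => w /=; rewrite enorm_le0 subr_eq0 => /eqP.
have N0 i j : P (N i j) = 0%E.
  by rewrite /N; case: ifPn => [_|]; [exact: measure0|exact: prob_coincide].
have : P.-negligible (\bigcup_i \bigcup_j N i j).
  apply: negligible_bigcup => i; apply: negligible_bigcup => j.
  by exists (N i j); split => //; exact: N0.
move=> [M [mM M0 NM]]; exists M; split => // w Mw i j Xij.
apply/eqP; apply: contra_notT Mw => ij; apply: NM; exists i => //; exists j => //.
by rewrite /N (negbTE ij).
Qed.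

End component_probability.

(** * Mean component counts *)

Lemma emeasurable_bigsum d (T : measurableType d) (R : realType)
    (I : finType) (Q : pred I) (f : I -> T -> \bar R) :
  (forall i, measurable_fun setT (f i)) ->
  measurable_fun setT (fun x => \sum_(i | Q i) f i x)%E.
Proof.
by move=> mf; under eq_fun do rewrite -big_filter; exact: emeasurable_sum.
Qed.

Lemma ge0_integral_bigsum d (T : measurableType d) (R : realType)
    (mu : {measure set T -> \bar R}) (I : finType) (Q : pred I)
    (f : I -> T -> \bar R) :
  (forall i, measurable_fun setT (f i)) -> (forall i x, 0 <= f i x)%E ->
  (\int[mu]_x (\sum_(i | Q i) f i x) = \sum_(i | Q i) \int[mu]_x f i x)%E.
Proof.
move=> mf f0; under eq_integral do rewrite -big_filter.
by rewrite ge0_integral_sum// big_filter.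
Qed.

Lemma first_points_count (R : realType) d (Omega : Type)
    (X : nat -> Omega -> 'rV[R]_d) (k m : nat) (r : R) (w : Omega) :
  injective (X ^~ w) ->
  (component_count k r (first_points X m w))%:R%:E =
  (\sum_(C : {set 'I_m} | #|C| == k)
    (\1_[set w | C \in comps (adj r (fun i : 'I_m => X i w))] w)%:E)%E :> \bar R.
Proof.
move=> XI; rewrite component_count_image; last by move=> i j _ _ /XI.
rewrite -sum1_card natr_sum sumEFin; congr EFin.
rewrite [LHS]big_mkcond [RHS]big_mkcond; apply: eq_bigr => C _.
rewrite inE indicE andbC; case: eqP => //= _.
rewrite (_ : w \in _ = (C \in comps (adj r (fun i : 'I_m => X i w)))).
  by case: ifP.
by apply/idP/idP => [/set_mem//|H]; exact/mem_set.
Qed.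

Section mean_counts.
Context dO (Omega : measurableType dO) (R : realType) (P : probability Omega R).
Context (d : nat).
Variables (X : nat -> {RV P >-> 'rV[R]_d}) (nu : probability 'rV[R]_d R).
Hypothesis X_law : forall i B, measurable B -> distribution P (X i) B = nu B.
Hypothesis X_indep : mutually_independent P X.
Hypothesis nu_atomless : forall x, nu [set x] = 0%E.
Variables (k : nat) (k_gt0 : (0 < k)%N).

Definition cluster_mean (r : R) (m : nat) : \bar R :=
  (\int[points_law X k]_y (cluster_density nu r m y)%:E)%E.

Let comp_event r m (C : {set 'I_m}) :=
  [set w | C \in comps (adj r (fun i : 'I_m => X i w))].

Let measurable_comp_event r m (C : {set 'I_m}) : measurable (comp_event r C).
Proof. by apply: measurable_mem_comps => i; exact: measurable_funPT. Qed.

(** All [k]-subsets of indices have the same probability. The factor [q] is 1 for a fixed number of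
    points and the probability of [Z = m] for a random one. *)
Let sum_comp_event r m (q : \bar R) :
  (\sum_(C : {set 'I_m} | #|C| == k) q * P (comp_event r C) =
   q * ('C(m, k)%:R%:E * cluster_mean r (m - k)))%E.
Proof.
under eq_bigr => C /eqP Ck do
  rewrite (prob_component X_law X_indep r k_gt0 Ck).
rewrite muleCA mule_natl sumr_const.
have -> : 'C(m, k) = #|[set C : {set 'I_m} | #|C| == k]%SET|.
  by rewrite card_draws card_ord.
by rewrite cardsE.
Qed.

Lemma mean_count (r : R) (m : nat) :
  (\int[P]_w (component_count k r (first_points X m w))%:R%:E =
   'C(m, k)%:R%:E * cluster_mean r (m - k))%E.
Proof.
have [N [mN N0 XI]] := coincidence_null X_law X_indep nu_atomless.
rewrite (ge0_integral_eq_off_null mN N0 (g := fun w =>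
    \sum_(C : {set 'I_m} | #|C| == k) (\1_(comp_event r C) w)%:E)%E).
- rewrite ge0_integral_bigsum//.
  - under eq_bigr do rewrite integral_indic// setIT.
    by rewrite -[RHS]mul1e -sum_comp_event; apply: eq_bigr => C _; rewrite mul1e.
  - by move=> C; exact/measurable_EFinP/measurable_indic.
- apply: emeasurable_bigsum => C; exact/measurable_EFinP/measurable_indic.
- by move=> w; rewrite lee_fin.
- by move=> w /XI; exact: first_points_count.
Qed.

Lemma mean_count_random (Z : {RV P >-> nat}) (r : R) :
  independent_of_family P Z X ->
  (\int[P]_w (component_count k r (first_points X (Z w) w))%:R%:E =
   \sum_(m <oo) distribution P Z [set m] *
     ('C(m, k)%:R%:E * cluster_mean r (m - k)))%E.
Proof.
move=> ZX.
have [N [mN N0 XI]] := coincidence_null X_law X_indep nu_atomless.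
have mZ m : measurable (Z @^-1` [set m]).
  by rewrite -[X in measurable X]setTI; exact: measurable_funPT.
have ZC m (C : {set 'I_m}) : P (Z @^-1` [set m] `&` comp_event r C) =
    (distribution P Z [set m] * P (comp_event r C))%E.
  apply: ZX => //.
  (* The event must be measurable for the sigma-algebra generated by the points, as
     [independent_of_family] demands. *)
  pose S := \bigcup_i preimage_set_system setT (X i) measurable.
  apply: (@measurable_mem_comps _ (g_sigma_algebraType S) R d 'I_m r
    (fun w i => X i w) C) => i _ B mB.
  by apply: sub_sigma_algebra; exists i => //; exists B.
pose F (m : nat) (w : Omega) : \bar R := (\sum_(C : {set 'I_m} | #|C| == k)
  (\1_(Z @^-1` [set m] `&` comp_event r C) w)%:E)%E.
have mF m : measurable_fun setT (F m).
  apply: emeasurable_bigsum => C; apply/measurable_EFinP/measurable_indic.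
  exact: measurableI.
have F0 m w : (0 <= F m w)%E.
  by apply: sume_ge0 => C _; rewrite lee_fin.
rewrite (ge0_integral_eq_off_null mN N0 (g := fun w => \sum_(m <oo) F m w)%E).
- rewrite integral_nneseries//; apply: eq_eseriesr => m _.
  rewrite ge0_integral_bigsum//.
  - rewrite -sum_comp_event; apply: eq_bigr => C _.
    by rewrite integral_indic ?setIT; [exact: ZC| |exact: measurableI].
  - by move=> C; apply/measurable_EFinP/measurable_indic; exact: measurableI.
- exact: ge0_emeasurable_sum.
- by move=> w; rewrite lee_fin.
(* At a given [w] only the term [m = Z w] is nonzero. *)
- move=> w /XI Xw; rewrite (@nneseriesD1 _ _ (Z w))// [X in (_ + X)%E]eseries0 ?adde0.
    rewrite first_points_count//; apply: eq_bigr => C _.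
    have Zw : w \in Z @^-1` [set Z w] by exact: mem_set.
    by rewrite !indicE in_setI Zw.
  move=> m _ mZw; rewrite /F big1// => C _.
  by rewrite indicE in_setI memNset// => Zm; rewrite Zm eqxx in mZw.
Qed.

End mean_counts.

(** * Volume and density bounds *)

Lemma measure_bigsetU_le d (T : measurableType d) (R : realType)
    (mu : {measure set T -> \bar R}) (I : Type) (s : seq I) (F : I -> set T) :
  (forall i, measurable (F i)) ->
  (mu (\big[setU/set0]_(i <- s) F i) <= \sum_(i <- s) mu (F i))%E.
Proof.
move=> mF; elim: s => [|i s IH]; first by rewrite !big_nil measure0.
rewrite !big_cons; apply: le_trans (measureU2 _ _ _) _ => //.
  exact: bigsetU_measurable.
exact: leeD2l.
Qed.

Section lebesgue_estimates.
Variables (R : realType) (d : nat).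
Implicit Types (x y z v : 'rV[R]_d) (r : R).

Lemma le_coord_enorm v i : `|v ord0 i| <= enorm v.
Proof.
rewrite -sqrtr_sqr ler_sqrt; last by apply: sumr_ge0 => j _; exact: sqr_ge0.
by rewrite (bigD1 i)//= lerDl sumr_ge0// => j _; exact: sqr_ge0.
Qed.

Lemma measurable_enorm_ball x r : measurable [set z | enorm (x - z) <= r].
Proof. exact: measurable_near. Qed.

Lemma measurable_rV_cube x r :
  measurable [set v : 'rV[R]_d | forall i, v ord0 i \in `[x ord0 i - r, x ord0 i + r]].
Proof.
apply: (measurable_rV_box (B := fun i => `[x ord0 i - r, x ord0 i + r]%classic)) => i.
exact: measurable_itv.
Qed.

Lemma lebesgue_rV_cube x r : 0 <= r ->
  lebesgue_rV [set v : 'rV[R]_d |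
    forall i, v ord0 i \in `[x ord0 i - r, x ord0 i + r]] = ((2 * r) ^+ d)%:E.
Proof.
move=> r0; rewrite lebesgue_rV_box; last by move=> i; rewrite lerD2l ge0_cp.
rewrite (eq_bigr (fun=> 2 * r)) ?prodr_const ?card_ord// => i _.
by ring.
Qed.

Lemma lebesgue_rV_ball x r : 0 <= r ->
  (lebesgue_rV [set z | (enorm (x - z) <= r)%R] <= ((2 * r) ^+ d)%:E)%E.
Proof.
move=> r0; rewrite -(lebesgue_rV_cube x r0); apply: le_measure.
- by rewrite inE; exact: measurable_enorm_ball.
- by rewrite inE; exact: measurable_rV_cube.
move=> z xz i; rewrite in_itv/= -ler_distlC.
apply: le_trans xz; have := le_coord_enorm (x - z) i.
by rewrite !mxE.
Qed.

Lemma measurable_rV_set1 x : measurable [set x].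
Proof.
rewrite (_ : [set x] = [set z | enorm (x - z) <= 0]).
  exact: measurable_enorm_ball.
apply/seteqP; split => z /=; rewrite enorm_le0 subr_eq0; first by move=> ->.
by move=> /eqP ->.
Qed.

Lemma lebesgue_rV_set1 x : (0 < d)%N -> lebesgue_rV [set x] = 0%E.
Proof.
move=> d0; apply/eqP; rewrite eq_le measure_ge0 andbT.
have -> : [set x] = [set z | enorm (x - z) <= 0].
  apply/seteqP; split => z /=; rewrite enorm_le0 subr_eq0; first by move=> ->.
  by move=> /eqP ->.
by apply: le_trans (lebesgue_rV_ball x (lexx 0)) _; rewrite mulr0 expr0n gtn_eqF.
Qed.

Lemma unit_ball_volume_gt0 : 0 < unit_ball_volume R d.
Proof.
have ballE : [set v : 'rV[R]_d | enorm v <= 1] = [set z | enorm (0 - z) <= 1].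
  by apply: eq_set => z; rewrite sub0r enormN.
have mB : measurable [set v : 'rV[R]_d | enorm v <= 1].
  by rewrite ballE; exact: measurable_enorm_ball.
apply: fine_gt0; apply/andP; split; last first.
  rewrite ballE; apply: le_lt_trans (lebesgue_rV_ball 0 ler01) _.
  by rewrite ltry.
(* A cube of half-side [s] fits in the unit ball, since the squares sum to at most [d * s <= 1]; the
   successor keeps [s] positive and at most 1 for every [d]. *)
pose s : R := d.+1%:R^-1.
have s0 : 0 < s by rewrite invr_gt0.
apply: (@lt_le_trans _ _ ((2 * s) ^+ d)%:E).
  by rewrite lte_fin exprn_gt0// mulr_gt0.
rewrite -(lebesgue_rV_cube 0 (ltW s0)); apply: le_measure.
- by rewrite inE; exact: measurable_rV_cube.
- by rewrite inE.
move=> z /= zs; rewrite /enorm -[leRHS]sqrtr1 ler_wsqrtr//.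
have s1 : s <= 1 by rewrite invf_le1// ler1n.
apply: (@le_trans _ _ (\sum_(i < d) s)).
  apply: ler_sum => i _; have := zs i; rewrite mxE sub0r add0r in_itv/= -ler_norml.
  move=> zis; rewrite -real_normK ?num_real// expr2.
  by apply: le_trans (ler_pM _ _ zis (le_trans zis s1)) _; rewrite ?mulr1.
rewrite sumr_const card_ord -mulr_natl ler_pdivrMr// mul1r ler_nat.
exact: leqnSn.
Qed.

End lebesgue_estimates.

Section support.
Variables (R : realType) (d : nat).

(** A countable base of the topology (rational centres, radii [1 / (n + 1)]), which ties open sets
    to the product sigma-algebra. *)
Let rat_cube (p : 'rV[rat]_d * nat) : set 'rV[R]_d :=
  rV_box (fun i => ball (ratr (p.1 ord0 i) : R) p.2.+1%:R^-1).

Let measurable_rat_cube p : measurable (rat_cube p).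
Proof. by apply: measurable_rV_box => i; exact: measurable_ball. Qed.

Lemma rat_cube_nbhs (U : set 'rV[R]_d) (x : 'rV[R]_d) : open U -> U x ->
  exists2 p, rat_cube p x & rat_cube p `<=` U.
Proof.
move=> oU Ux; have /nbhs_ballP[e /= e0 eU] := open_nbhs_nbhs (conj oU Ux).
have [n ne] : exists n : nat, n.+1%:R^-1 < e / 2.
  have e2 : 0 < e / 2 by rewrite divr_gt0.
  by have [n] := ltr_add_invr e2; rewrite add0r; exists n.
have n0 : 0 < n.+1%:R^-1 :> R by rewrite invr_gt0.
have xq i : exists q, x ord0 i - n.+1%:R^-1 < ratr q < x ord0 i + n.+1%:R^-1.
  have /rat_in_itvoo[q] : x ord0 i - n.+1%:R^-1 < x ord0 i + n.+1%:R^-1.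
    by rewrite (lt_trans (_ : _ < x ord0 i)) ?ltrDl// ltrBlDr ltrDl.
  by rewrite in_itv/= => qx; exists q.
pose q : 'rV[rat]_d := \row_i xchoose (xq i).
have qx i : `|ratr (q ord0 i) - x ord0 i| < n.+1%:R^-1.
  by have := xchooseP (xq i); rewrite mxE ltr_distl.
exists (q, n) => [i|z qz]; first exact: qx.
apply: eU; split => // i j; rewrite (ord1 i) /ball /=.
have := qz j; rewrite /ball /= => qzj.
rewrite -(subrK (ratr (q ord0 j)) (x 0 j)) -addrA.
apply: le_lt_trans (ler_normD _ _) _; rewrite (splitr e) ltrD//.
  by rewrite distrC; exact: lt_trans (qx j) ne.
exact: lt_trans qzj ne.
Qed.

Lemma measurable_open_rV (U : set 'rV[R]_d) : open U -> measurable U.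
Proof.
move=> oU.
have -> : U = \bigcup_(p in [set: _])
    (if `[< rat_cube p `<=` U >] then rat_cube p else set0).
  apply/seteqP; split => [x Ux|x [p _]].
    have [p px pU] := rat_cube_nbhs oU Ux.
    by exists p => //; case: asboolP.
  by case: asboolP => // pU; exact: pU.
apply: countable_bigcupT_measurable => // p; case: ifP => // _.
Qed.

(** Each point off the support lies in a null open set, hence in a null rational cube, and there are
    countably many of these. *)
Lemma msupport_full (nu : {measure set 'rV[R]_d -> \bar R}) :
  nu.-negligible (~` msupport nu).
Proof.
pose N p := if nu (rat_cube p) == 0%E then rat_cube p else set0.
pose F k := if choice.unpickle k is Some p then N p else set0.
have N0 p : nu.-negligible (N p).
  rewrite /N; case: eqP => [p0|_]; last exact: negligible_set0.
  by exists (rat_cube p); split.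
have : nu.-negligible (\bigcup_k F k).
  apply: negligible_bigcup => k; rewrite /F; case: choice.unpickle => [p|]; first exact: N0.
  exact: negligible_set0.
apply: negligibleS => x /existsNP[U /not_implyP[oU /not_implyP[Ux /negP]]].
rewrite -leNgt => U0; have [p px pU] := rat_cube_nbhs oU Ux.
exists (choice.pickle p) => //; rewrite /F choice.pickleK /N.
have -> : nu (rat_cube p) == 0%E; last by [].
rewrite eq_le measure_ge0 andbT; apply: le_trans U0.
by apply: le_measure => //; rewrite inE//; exact: measurable_open_rV.
Qed.

(** The density is bounded only on the support, so a null set covering the complement of the support
    is removed from [B] first. *)
Lemma density_le (nu : {measure set 'rV[R]_d -> \bar R}) (f : 'rV[R]_d -> R) (M : R) :
  0 <= M -> has_density nu f -> (forall x, msupport nu x -> f x <= M) ->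
  forall B, measurable B -> (nu B <= M%:E * lebesgue_rV B)%E.
Proof.
move=> M0 [f0 mf nuE] fM B mB.
have [N [mN N0 AN]] := msupport_full nu.
have mBN : measurable (B `\` N) by exact: measurableD.
have -> : nu B = nu (B `\` N).
  rewrite (measureDI nu mB mN) [X in (_ + X)%E](_ : _ = 0%E) ?adde0//.
  apply/eqP; rewrite eq_le measure_ge0 andbT -N0.
  by apply: le_measure; rewrite ?inE//; exact: measurableI.
rewrite nuE//; apply: (@le_trans _ _ (\int[@lebesgue_rV R d]_(x in B `\` N) M%:E)%E).
  apply: ge0_le_integral => //.
  - by move=> x _; rewrite lee_fin.
  - by apply/measurable_EFinP; exact: measurable_funTS.
  - by move=> x [_ Nx]; rewrite lee_fin fM//; apply: contrapT => /AN.
rewrite integral_cst//; apply: lee_wpmul2l; first by rewrite lee_fin.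
by apply: le_measure; rewrite ?inE.
Qed.

Lemma density_atomless (nu : {measure set 'rV[R]_d -> \bar R}) (f : 'rV[R]_d -> R) :
  (0 < d)%N -> has_density nu f -> forall x, nu [set x] = 0%E.
Proof.
move=> d0 [f0 mf nuE] x; rewrite nuE; last exact: measurable_rV_set1.
apply: null_set_integral.
- exact: measurable_rV_set1.
- by apply/measurable_EFinP; exact: measurable_funTS.
- exact: lebesgue_rV_set1.
Qed.

Lemma compact_density_bound (A : set 'rV[R]_d) (f : 'rV[R]_d -> R) :
  compact A -> {within A, continuous f} ->
  exists2 M, 0 <= M & forall x, A x -> f x <= M.
Proof.
move=> cA cf; have [M [_ fM]] := compact_bounded (continuous_compact cf cA).
exists (`|M| + 1); first by rewrite addr_ge0.
move=> x Ax; apply: le_trans (ler_norm _) _; apply: fM; last by exists x.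
by apply: le_lt_trans (ler_norm M) _; rewrite ltrDl.
Qed.

(** Union bound: the complement of [far_set] is the union of [k] balls of radius [r], each contained
    in a cube of side [2 * r]. *)
Lemma avoid_prob_ge (nu : probability 'rV[R]_d R) (f : 'rV[R]_d -> R) (M r : R)
    (k : nat) (y : 'rV['rV[R]_d]_k) :
  0 <= M -> 0 <= r -> has_density nu f ->
  (forall x, msupport nu x -> f x <= M) ->
  1 - k%:R * (M * (2 * r) ^+ d) <= avoid_prob nu r y.
Proof.
move=> M0 r0 nuf fM.
have mfar := measurable_far_set r y.
rewrite lerBlDr -lerBlDl -lee_fin EFinB avoid_probE -probability_setC//.
have -> : ~` far_set r y = \big[setU/set0]_(i < k) [set z | enorm (y ord0 i - z) <= r].
  rewrite -bigcup_seq; apply/seteqP; split => z.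
    move=> /negP; rewrite negb_forall => /existsP[i].
    rewrite negb_forall => /existsP[j]; rewrite negbK => yz.
    by exists i => //=; rewrite mem_index_enum.
  move=> [i _ /= yz] /= /'forall_forallP /(_ i ord0) /negP; exact.
apply: (@le_trans _ _ (\sum_(i < k) nu [set z | (enorm (y ord0 i - z) <= r)%R])%E).
  by apply: measure_bigsetU_le => i; exact: measurable_enorm_ball.
apply: (@le_trans _ _ (\sum_(i < k) (M * (2 * r) ^+ d)%:E)%E).
  apply: lee_sum => i _.
  apply: (le_trans (density_le M0 nuf fM (measurable_enorm_ball _ _))).
  by rewrite EFinM lee_wpmul2l ?lee_fin// lebesgue_rV_ball.
by rewrite sumEFin lee_fin sumr_const card_ord [leRHS]mulr_natl.
Qed.

End support.

(** * Binomial and Poisson weights *)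

Section binomial_poisson.
Variable R : realType.
Implicit Types (q p x : R) (n k : nat).

Definition poisson_weight (n k : nat) (q : R) : R :=
  n%:R ^+ k / k`!%:R * expR (- (n%:R * (1 - q))).

Lemma poisson_weight_ge0 n k q : 0 <= poisson_weight n k q.
Proof. by rewrite mulr_ge0// ?expR_ge0// divr_ge0// exprn_ge0. Qed.

(** The terms [m < k] vanish; with [m = j + k] the factor [(j + k)!] cancels against the binomial
    coefficient and leaves the exponential series at [n * q]. *)
Lemma poisson_binomial_sum n k q : (0 < n)%N -> 0 <= q ->
  (\sum_(m <oo) (poisson_pmf n%:R m * ('C(m, k)%:R * q ^+ (m - k)))%:E =
   (poisson_weight n k q)%:E)%E.
Proof.
move=> n0 q0; have nR : 0 < n%:R :> R by rewrite ltr0n.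
pose f m : \bar R := (poisson_pmf n%:R m * ('C(m, k)%:R * q ^+ (m - k)))%:E.
rewrite -[LHS]/(\sum_(m <oo) f m)%E.
have f0 m : (0 <= f m)%E.
  by rewrite lee_fin mulr_ge0 ?poisson_pmf_ge0// mulr_ge0// exprn_ge0.
rewrite (@nneseries_split _ f 0%N k)// big1_seq ?add0e; last first.
  move=> m; rewrite mem_index_iota add0n => /andP[_ mk].
  by rewrite /f bin_small// mul0r mulr0.
rewrite add0n -nneseries_addn//.
pose c : R := n%:R ^+ k / k`!%:R * expR (- n%:R).
rewrite (@eq_eseriesr _ _ (fun j => c%:E * (exp_coeff (n%:R * q) j)%:E)%E); last first.
  move=> j _; rewrite /f -EFinM; congr EFin.
  rewrite /poisson_pmf nR /c /exp_coeff addnK.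
  have kf : k`!%:R != 0 :> R by rewrite pnatr_eq0 -lt0n fact_gt0.
  have jf : j`!%:R != 0 :> R by rewrite pnatr_eq0 -lt0n fact_gt0.
  have jkf : (j + k)`!%:R != 0 :> R by rewrite pnatr_eq0 -lt0n fact_gt0.
  have binE : 'C(j + k, k)%:R = (j + k)`!%:R / (k`!%:R * j`!%:R) :> R.
    apply: (mulIf (mulf_neq0 kf jf)); rewrite divfK ?mulf_neq0//.
    by rewrite -!natrM -[in RHS](@bin_fact (j + k) k) ?leq_addl// addnK.
  rewrite binE exprD /= exprMn.
  by field; rewrite kf jf jkf.
rewrite nneseriesZl; last first.
  by move=> j _; rewrite lee_fin exp_coeff_ge0// mulr_ge0.
have -> : (\sum_(j <oo) (exp_coeff (n%:R * q) j)%:E = (expR (n%:R * q))%:E)%E.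
  rewrite -EFin_lim; last exact: is_cvg_series_exp_coeff.
  by apply/congr_lim/funext => m /=; rewrite /series/= -sumEFin.
rewrite -EFinM; congr EFin; rewrite /c /poisson_weight -!mulrA -expRD.
by congr (_ * (_ * expR _)); ring.
Qed.

Lemma bernoulli_le n x : 0 <= x -> x <= 1 -> 1 - n%:R * x <= (1 - x) ^+ n.
Proof.
move=> x0 x1; elim: n => [|n IH]; first by rewrite mul0r subr0 expr0.
rewrite exprS -natr1; apply: (@le_trans _ _ ((1 - x) * (1 - n%:R * x))).
  have : 0 <= n%:R :> R by []. nra.
by apply: ler_wpM2l => //; rewrite subr_ge0.
Qed.

(** From exp (- x) >= 1 - x, and 1 / (1 - x) <= 1 + 2 x on this range. *)
Lemma expR_le_1D2 x : 0 <= x -> x <= 1 / 2 -> expR x <= 1 + 2 * x.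
Proof.
move=> x0 x2; have : expR (- x) >= 1 - x by have := expR_ge1Dx (- x).
rewrite expRN => ex.
have e0 := expR_gt0 x.
have : (1 - x) * expR x <= 1 by rewrite -ler_pdivlMr// div1r.
nra.
Qed.

Lemma ffact_le n k : (n ^_ k <= n ^ k)%N.
Proof.
elim: k n => [|k IH] n; first by rewrite ffactn0 expn0.
case: n => [|n]; first by rewrite ffact0n.
rewrite ffactnS /= expnS leq_mul//; apply: leq_trans (IH n) _.
by case: k {IH} => // k; rewrite leq_exp2r.
Qed.

Lemma ffact_ge n k : ((n - k) ^ k <= n ^_ k)%N.
Proof.
elim: k n => [|k IH] n; first by rewrite ffactn0 expn0.
case: n => [|n]; first by rewrite sub0n exp0n.
rewrite ffactnS /= expnS subSS leq_mul ?IH//.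
by rewrite (leq_trans (leq_subr _ _)).
Qed.

Lemma bin_ratio_le n k : 'C(n, k)%:R <= n%:R ^+ k / k`!%:R :> R.
Proof.
by rewrite ler_pdivlMr ?ltr0n ?fact_gt0// -natrM bin_ffact -natrX ler_nat ffact_le.
Qed.

(** The falling factorial is at least (n - k)^k = n^k (1 - k / n)^k, to which Bernoulli's inequality
    applies. *)
Lemma bin_ratio_ge n k : (0 < n)%N -> (k <= n)%N ->
  (1 - k%:R ^+ 2 / n%:R) * (n%:R ^+ k / k`!%:R) <= 'C(n, k)%:R :> R.
Proof.
move=> n0 kn; have nR : 0 < n%:R :> R by rewrite ltr0n.
rewrite mulrA ler_pdivrMr ?ltr0n ?fact_gt0// -natrM bin_ffact.
apply: (@le_trans _ _ (((n - k) ^ k)%N%:R)); last by rewrite ler_nat ffact_ge.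
rewrite natrX natrB//.
have -> : n%:R - k%:R = (1 - k%:R / n%:R) * n%:R :> R.
  by rewrite mulrBl mul1r divfK// gt_eqF.
rewrite exprMn ler_wpM2r ?exprn_ge0//.
apply: le_trans (bernoulli_le _ _ _); last 2 first.
- by rewrite divr_ge0.
- by rewrite ler_pdivrMr// mul1r ler_nat.
by rewrite mulrA -expr2.
Qed.

(** Since exp p >= 1 + p, multiplying (1 - p)^n by exp (n p) gives at least (1 - p^2)^n, and
    Bernoulli's inequality bounds this from below. *)
Lemma expR_pow_ge n p : 0 <= p -> p <= 1 ->
  (1 - n%:R * p ^+ 2) * expR (- (n%:R * p)) <= (1 - p) ^+ n.
Proof.
move=> p0 p1; rewrite expRN ler_pdivrMr ?expR_gt0// expRM_natl -exprMn.
apply: (@le_trans _ _ ((1 - p ^+ 2) ^+ n)).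
  by apply: bernoulli_le; [exact: sqr_ge0|exact: exprn_ile1].
have -> : 1 - p ^+ 2 = (1 - p) * (1 + p) by ring.
have p1' : 0 <= 1 - p by rewrite subr_ge0.
have ep : 0 <= expR p by exact: expR_ge0.
have p1D : 0 <= 1 + p by rewrite addr_ge0.
apply: lerXn2r; rewrite ?nnegrE ?mulr_ge0//.
by apply: ler_wpM2l => //; exact: expR_ge1Dx.
Qed.

(** Here [p] stands for 1 - q(y) and [pb] for its bound uniform in y. The exponent [n - k] instead
    of [n] costs exp (k p). *)
Lemma binomial_poisson_le n k p pb : (k <= n)%N -> 0 <= p -> p <= pb -> p <= 1 ->
  k%:R * pb <= 1 / 2 ->
  'C(n, k)%:R * (1 - p) ^+ (n - k) <=
  (1 + 2 * (k%:R * pb)) * poisson_weight n k (1 - p).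
Proof.
move=> kn p0 pbp p1 kpb.
have k0 : 0 <= k%:R :> R by [].
rewrite /poisson_weight subKr mulrCA ler_pM//.
- by rewrite exprn_ge0// subr_ge0.
- exact: bin_ratio_le.
apply: (@le_trans _ _ (expR (- p) ^+ (n - k))).
  by apply: lerXn2r; rewrite ?nnegrE ?expR_ge0 ?subr_ge0// expR_ge1Dx.
rewrite -expRM_natl natrB//.
have -> : (n%:R - k%:R) * - p = k%:R * p + - (n%:R * p) by ring.
rewrite expRD ler_wpM2r ?expR_ge0//.
apply: (@le_trans _ _ (expR (k%:R * pb))); first by rewrite ler_expR ler_wpM2l.
by apply: expR_le_1D2 => //; rewrite mulr_ge0// (le_trans p0).
Qed.

Lemma binomial_poisson_ge n k p pb : (0 < n)%N -> (k <= n)%N ->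
  0 <= p -> p <= pb -> p <= 1 ->
  (1 - (k%:R ^+ 2 / n%:R + n%:R * pb ^+ 2)) * poisson_weight n k (1 - p) <=
  'C(n, k)%:R * (1 - p) ^+ (n - k).
Proof.
move=> n0 kn p0 pbp p1; have nR : 0 < n%:R :> R by rewrite ltr0n.
rewrite /poisson_weight subKr.
set a := k%:R ^+ 2 / n%:R; set T := n%:R ^+ k / _; set e := expR _.
have T0 : 0 <= T by rewrite divr_ge0// exprn_ge0.
have e0 : 0 <= e by exact: expR_ge0.
have a0 : 0 <= a by rewrite divr_ge0// exprn_ge0.
set C : R := 'C(n, k)%:R; have CT : (1 - a) * T <= C by exact: bin_ratio_ge.
have C0 : 0 <= C by [].
have b0 : 0 <= n%:R * p ^+ 2 by rewrite mulr_ge0// sqr_ge0.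
have q0 : 0 <= 1 - p by rewrite subr_ge0.
have qe : (1 - n%:R * p ^+ 2) * e <= (1 - p) ^+ (n - k).
  apply: le_trans (expR_pow_ge n p0 p1) _.
  by apply: ler_wiXn2l => //; [rewrite gerBl|exact: leq_subr].
have pp : n%:R * p ^+ 2 <= n%:R * pb ^+ 2.
  by rewrite ler_wpM2l// lerXn2r// nnegrE// (le_trans p0).
have Te0 : 0 <= T * e by rewrite mulr_ge0.
apply: (@le_trans _ _ ((1 - (a + n%:R * p ^+ 2)) * (T * e))).
  by rewrite ler_wpM2r// lerD2l lerN2 lerD2l.
(* If either error exceeds 1, the claimed lower bound is nonpositive; otherwise both factors are
   nonnegative and (1 - a) (1 - b) >= 1 - (a + b). *)
have [a1|a1] := lerP a 1; last first.
  apply: (@le_trans _ _ 0); last by rewrite mulr_ge0// exprn_ge0.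
  by rewrite mulr_le0_ge0//; lra.
have [b1|b1] := lerP (n%:R * p ^+ 2) 1; last first.
  apply: (@le_trans _ _ 0); last by rewrite mulr_ge0// exprn_ge0.
  by rewrite mulr_le0_ge0//; lra.
apply: (@le_trans _ _ (((1 - a) * T) * ((1 - n%:R * p ^+ 2) * e))).
  rewrite mulrACA ler_wpM2r//.
  have := mulr_ge0 a0 b0. lra.
by apply: ler_pM => //; rewrite mulr_ge0// subr_ge0.
Qed.

End binomial_poisson.

(** * Comparison of the binomial and Poisson means *)

Section de_poissonization.
Context dO (Omega : measurableType dO) (R : realType) (P : probability Omega R).
Context (d : nat).
Variables (X : nat -> {RV P >-> 'rV[R]_d}) (nu : probability 'rV[R]_d R).
Variables (k : nat) (r : R).

Local Notation mu := (points_law X k).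

(** Both integrands have this shape and differ only in [g], so inequalities between weights in [q]
    pass to the means. *)
Let weighted (g : R -> R) (y : 'rV['rV[R]_d]_k) : R :=
  (conn r (y ord0))%:R * g (avoid_prob nu r y).

Let measurable_weighted g : measurable_fun setT g ->
  measurable_fun setT (EFin \o weighted g).
Proof.
move=> mg; apply/measurable_EFinP; apply: measurable_funM; last first.
  exact: measurableT_comp mg (measurable_avoid_prob _ _).
have mc : measurable [set y : 'rV['rV[R]_d]_k | conn r (y ord0)].
  by apply: measurable_conn => i; exact: measurable_coord.
rewrite (_ : (fun _ => _) = \1_[set y : 'rV['rV[R]_d]_k | conn r (y ord0)]).
  exact: measurable_indic.
apply/funext => y; rewrite indicE (_ : (y \in _) = conn r (y ord0))//.
by apply/idP/idP => [/set_mem//|H]; exact: mem_set.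
Qed.

Let weighted_ge0 g y : (forall q, 0 <= q -> 0 <= g q) -> (0 <= (weighted g y)%:E)%E.
Proof. by move=> g0; rewrite lee_fin mulr_ge0// g0// avoid_prob_ge0. Qed.

Definition poisson_mean (n : nat) : \bar R :=
  (\int[mu]_y (weighted (poisson_weight n k) y)%:E)%E.

Lemma measurable_poisson_weight n : measurable_fun setT (@poisson_weight R n k).
Proof.
apply: measurable_funM => //; apply: measurableT_comp => //.
apply: measurable_funN; apply: measurable_funM => //.
exact: measurable_funB.
Qed.

(** Tonelli exchanges sum and integral; [poisson_binomial_sum] then evaluates the sum for each
    [y]. *)
Lemma poisson_meanE (n : nat) : (0 < n)%N ->
  (\sum_(m <oo) (poisson_pmf n%:R m)%:E *
     ('C(m, k)%:R%:E * cluster_mean X nu k r (m - k)))%E = poisson_mean n.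
Proof.
move=> n0.
pose g m q := poisson_pmf n%:R m * ('C(m, k)%:R * q ^+ (m - k)) : R.
have g0 m q : 0 <= q -> 0 <= g m q.
  by move=> q0; rewrite mulr_ge0 ?poisson_pmf_ge0// mulr_ge0// exprn_ge0.
have mX m : measurable_fun setT (fun q : R => q ^+ m).
  exact: measurable_funX.
have mg m : measurable_fun setT (g m).
  by apply: measurable_funM => //; apply: measurable_funM.
transitivity (\sum_(m <oo) \int[mu]_y (weighted (g m) y)%:E)%E.
  apply: eq_eseriesr => m _; rewrite muleA -EFinM /cluster_mean.
  rewrite -ge0_integralZl_EFin//.
  - by apply: eq_integral => y _; rewrite -EFinM /g /weighted /cluster_density;
      congr EFin; ring.
  - by move=> y _; rewrite lee_fin cluster_density_ge0.
  - exact: measurable_weighted (mX _).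
  - by rewrite mulr_ge0 ?poisson_pmf_ge0.
rewrite -integral_nneseries//; last 2 first.
- by move=> m; exact: measurable_weighted.
- by move=> m y _; exact: weighted_ge0 (g0 m).
apply: eq_integral => y _; rewrite /weighted.
under eq_eseriesr do rewrite EFinM.
rewrite nneseriesZl; last by move=> m _; rewrite lee_fin g0// avoid_prob_ge0.
by rewrite poisson_binomial_sum// avoid_prob_ge0.
Qed.

(** The weight is at most n^k / k! and the law of the points is a probability; finiteness allows the
    later division by this mean. *)
Lemma poisson_mean_fin_num n : poisson_mean n \is a fin_num.
Proof.
rewrite ge0_fin_numE; last first.
  by apply: integral_ge0 => y _; apply: weighted_ge0 => q _; exact: poisson_weight_ge0.
apply: (@le_lt_trans _ _ (\int[mu]_y (n%:R ^+ k / k`!%:R)%:E)%E); last first.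
  rewrite integral_cst// [X in (_ * X)%E](_ : _ = 1%E) ?mule1 ?ltry//.
  exact: probability_setT.
apply: ge0_le_integral => //.
- by move=> y _; apply: weighted_ge0 => q _; exact: poisson_weight_ge0.
- exact: measurable_weighted (measurable_poisson_weight n).
move=> y _; rewrite lee_fin /weighted /poisson_weight.
have q1 := avoid_prob_le1 nu r y.
rewrite -[leRHS]mul1r ler_pM//.
  by case: conn.
rewrite ler_piMr ?divr_ge0 ?exprn_ge0// -[leRHS]expR0 ler_expR oppr_le0.
by rewrite mulr_ge0// subr_ge0.
Qed.

Lemma binomial_mean_approx (n : nat) (pb : R) :
  (0 < n)%N -> (k <= n)%N -> 0 <= pb -> k%:R * pb <= 1 / 2 ->
  (forall y : 'rV['rV[R]_d]_k, 1 - pb <= avoid_prob nu r y) ->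
  exists2 eps : R,
    `|eps| <= k%:R ^+ 2 / n%:R + n%:R * pb ^+ 2 + 2 * (k%:R * pb) &
    ('C(n, k)%:R%:E * cluster_mean X nu k r (n - k) =
     poisson_mean n * (1 + eps)%:E)%E.
Proof.
move=> n0 kn pb0 kpb qpb.
set del := _ + _ + _.
pose g q : R := 'C(n, k)%:R * q ^+ (n - k).
have mg : measurable_fun setT g.
  by apply: measurable_funM => //; exact: measurable_funX.
have g0 q : 0 <= q -> 0 <= g q by move=> q0; rewrite mulr_ge0// exprn_ge0.
pose t := @poisson_weight R n k.
have mt : measurable_fun setT t := measurable_poisson_weight n.
have t0 q : 0 <= q -> 0 <= t q by move=> _; exact: poisson_weight_ge0.
have nR : 0 < n%:R :> R by rewrite ltr0n.
have del1 : 0 <= k%:R ^+ 2 / n%:R + n%:R * pb ^+ 2 :> R.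
  by rewrite addr_ge0// ?divr_ge0 ?exprn_ge0// mulr_ge0// sqr_ge0.
have del2 : 0 <= 2 * (k%:R * pb) by rewrite !mulr_ge0.
have del0 : 0 <= del by rewrite addr_ge0.
have -> : ('C(n, k)%:R%:E * cluster_mean X nu k r (n - k) =
           \int[mu]_y (weighted g y)%:E)%E.
  rewrite /cluster_mean -ge0_integralZl_EFin//.
  - by apply: eq_integral => y _; rewrite -EFinM /g /weighted /cluster_density;
      congr EFin; ring.
  - by move=> y _; rewrite lee_fin cluster_density_ge0.
  - by apply: (measurable_weighted (g := fun q => q ^+ (n - k))); exact: measurable_funX.
have gt y : weighted g y <= (1 + del) * weighted t y.
  rewrite /weighted [leRHS]mulrCA ler_wpM2l//.
  have := @binomial_poisson_le R n k (1 - avoid_prob nu r y) pb kn.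
  rewrite subr_ge0 avoid_prob_le1 lerBlDl -lerBlDr qpb gerBl avoid_prob_ge0 subKr.
  move=> /(_ isT isT isT kpb); move=> /le_trans; apply.
  by rewrite ler_wpM2r ?t0 ?avoid_prob_ge0// lerD2l lerDr.
(* The bound [(1 - del) * t <= g] is kept with [del] on the right, so that only nonnegative
   functions are integrated even if [del > 1]. *)
have tg y : weighted t y <= weighted g y + del * weighted t y.
  rewrite /weighted [X in _ + X]mulrCA -mulrDr ler_wpM2l// -lerBlDr -{1}[t _]mul1r -mulrBl.
  have := @binomial_poisson_ge R n k (1 - avoid_prob nu r y) pb n0 kn.
  rewrite subr_ge0 avoid_prob_le1 lerBlDl -lerBlDr qpb gerBl avoid_prob_ge0 subKr.
  move=> /(_ isT isT isT); apply: le_trans.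
  by rewrite ler_wpM2r ?t0 ?avoid_prob_ge0// lerD2l lerN2 lerDl.
have It : (0 <= poisson_mean n)%E.
  by apply: integral_ge0 => y _; exact: weighted_ge0.
have Ig : (0 <= \int[mu]_y (weighted g y)%:E)%E.
  by apply: integral_ge0 => y _; exact: weighted_ge0.
have ub : (\int[mu]_y (weighted g y)%:E <= (1 + del)%:E * poisson_mean n)%E.
  rewrite -ge0_integralZl_EFin//; last 3 first.
  - by move=> y _; exact: weighted_ge0.
  - exact: measurable_weighted.
  - by rewrite addr_ge0.
  apply: ge0_le_integral => //.
  - by move=> y _; exact: weighted_ge0.
  - exact: measurable_weighted.
  - by apply: measurable_funeM; exact: measurable_weighted.
  - by move=> y _; rewrite -EFinM lee_fin.
have lb : (poisson_mean n <= \int[mu]_y (weighted g y)%:E + del%:E * poisson_mean n)%E.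
  rewrite -ge0_integralZl_EFin//; last 2 first.
  - by move=> y _; exact: weighted_ge0.
  - exact: measurable_weighted.
  rewrite -ge0_integralD//; last 4 first.
  - by move=> y _; exact: weighted_ge0.
  - exact: measurable_weighted.
  - by move=> y _; rewrite mule_ge0// weighted_ge0.
  - by apply: measurable_funeM; exact: measurable_weighted.
  apply: ge0_le_integral => //.
  - by move=> y _; exact: weighted_ge0.
  - exact: measurable_weighted.
  - apply: emeasurable_funD; first exact: measurable_weighted.
    by apply: measurable_funeM; exact: measurable_weighted.
  - by move=> y _; rewrite -EFinM -EFinD lee_fin.
have Ifin := poisson_mean_fin_num n.
move: Ifin It Ig ub lb; move: (poisson_mean n) => [I| |]// _ I0.
case: (\int[mu]_y (weighted g y)%:E)%E => [J| |] //; last first.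
rewrite -!EFinM -!EFinD !lee_fin in I0 * => J0 ub lb.
(* A zero Poisson mean forces a zero binomial mean by the upper bound, and any small [eps] works;
   otherwise [eps] is the ratio of the means minus 1. *)
have [I_0|In0] := eqVneq I 0.
  exists 0; first by rewrite normr0.
  rewrite -EFinM; congr EFin; rewrite I_0 mul0r; apply/eqP.
  by rewrite eq_le J0 andbT; move: ub; rewrite I_0 mulr0.
have I_gt0 : 0 < I by rewrite lt_def In0.
exists (J / I - 1).
  rewrite ler_norml; apply/andP; split; last by rewrite lerBlDl ler_pdivrMr.
  by rewrite lerBrDl ler_pdivlMr// mulrBl mul1r lerBlDr.
by rewrite -EFinM; congr EFin; field.
Qed.

End de_poissonization.

(** * Exponential smallness of the error and conclusion *)

Lemma limn_esup_lt_near (R : realType) (a : R^nat) (l : R) :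
  (limn_esup (fun n => (a n)%:E) < l%:E)%E -> \forall n \near \oo, a n <= l.
Proof.
move=> /ereal_inf_lt[_ [V oV <-] Vl]; apply: filterS oV => n Vn.
rewrite -lee_fin; apply: le_trans (ltW Vl).
by apply: ereal_sup_ubound; exists n.
Qed.

(** Termwise: exp (c u) dominates 1 and c u, and its square root exp (c u / 2) dominates c u / 2,
    whence the 4. *)
Lemma quadratic_le_expR (R : realType) (c u : R) : 0 < c -> 0 <= u ->
  1 + u + u ^+ 2 <= (1 + c^-1 + 4 * c^-2) * expR (c * u).
Proof.
move=> c0 u0; have cu0 : 0 <= c * u by rewrite mulr_ge0// ltW.
have ci : c^-1 * c = 1 by rewrite mulVf// gt_eqF.
have ci0 : 0 < c^-1 by rewrite invr_gt0.
rewrite (mulrDl (1 + c^-1)) (mulrDl 1) mul1r; apply: lerD; first apply: lerD.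
- by rewrite -[leLHS]expR0 ler_expR.
- rewrite -[leLHS]mul1r -ci -mulrA ler_wpM2l// ?(ltW ci0)//.
  by apply: le_trans (expR_ge1Dx _); rewrite lerDr.
have -> : expR (c * u) = expR (c * u / 2) ^+ 2.
  by rewrite -expRM_natl; congr expR; field.
have e0 : c * u / 2 <= expR (c * u / 2).
  by apply: le_trans (expR_ge1Dx _); rewrite lerDr.
have -> : u ^+ 2 = 4 * c^-2 * (c * u / 2) ^+ 2 by field; rewrite gt_eqF.
rewrite ler_wpM2l//; first by rewrite mulr_ge0// invr_ge0 exprn_ge0// ltW.
by rewrite lerXn2r// nnegrE ?expR_ge0// divr_ge0.
Qed.

(* In the application [u = n r^d] is [O(log n)], which gives [exp (2 c u) <= n]
   for small [c]. *)
Lemma error_le_expR (R : realType) (n k : nat) (C c u : R) :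
  (0 < n)%N -> 0 <= C -> 0 < c -> 0 <= u -> expR (2 * c * u) <= n%:R ->
  k%:R ^+ 2 / n%:R + n%:R * (C * u / n%:R) ^+ 2 + 2 * (k%:R * (C * u / n%:R)) <=
  (k%:R ^+ 2 + C ^+ 2 + 2 * k%:R * C) * (1 + c^-1 + 4 * c^-2) * expR (- c * u).
Proof.
move=> n0 C0 c0 u0 cun; have nR : 0 < n%:R :> R by rewrite ltr0n.
set K := k%:R ^+ 2 + C ^+ 2 + _; set K' := 1 + c^-1 + _.
have k0 : 0 <= k%:R :> R by [].
have K0 : 0 <= K by rewrite !addr_ge0 ?sqr_ge0// !mulr_ge0.
apply: (@le_trans _ _ (K * (1 + u + u ^+ 2) / n%:R)).
  have -> : k%:R ^+ 2 / n%:R + n%:R * (C * u / n%:R) ^+ 2 +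
      2 * (k%:R * (C * u / n%:R)) =
      (k%:R ^+ 2 + C ^+ 2 * u ^+ 2 + 2 * k%:R * C * u) / n%:R.
    by field; rewrite gt_eqF.
  rewrite ler_wpM2r ?invr_ge0 ?(ltW nR)// /K.
  have : 0 <= k%:R ^+ 2 * (u + u ^+ 2) by rewrite mulr_ge0 ?sqr_ge0// addr_ge0// sqr_ge0.
  have : 0 <= C ^+ 2 * (1 + u) by rewrite mulr_ge0 ?sqr_ge0// addr_ge0.
  have : 0 <= 2 * k%:R * C * (1 + u ^+ 2).
    by rewrite !mulr_ge0// addr_ge0// sqr_ge0.
  lra.
(* One factor exp (c u) pays for the polynomial; the other, left over from exp (2 c u) <= n, is the
   rate. *)
rewrite -!mulrA ler_wpM2l// ler_pdivrMr//.
apply: le_trans (quadratic_le_expR c0 u0) _.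
rewrite -mulrA ler_wpM2l//.
  by rewrite !addr_ge0 ?mulr_ge0// ?invr_ge0 ?exprn_ge0 ?(ltW c0).
rewrite mulNr expRN -ler_pdivrMl ?invr_gt0 ?expR_gt0// invrK -expRD.
by rewrite (_ : c * u + c * u = 2 * c * u)//; ring.
Qed.

Theorem proposition3p2 (R : realType) (d : nat) (hd : (0 < d)%N)
  (A : set 'rV[R]_d)
  (A_compact : compact A)
  (A_volume : (0 < lebesgue_rV A)%E)
  (A_boundary : (1 < d)%N -> C11_boundary A)
  (A_interval : d = 1%N ->
     forall i : 'I_d, is_interval [set v ord0 i | v in A])
  (nu : probability 'rV[R]_d R) (f : 'rV[R]_d -> R)
  (nu_density : has_density nu f)
  (nu_support : msupport nu = A)
  (f_continuous : {within A, continuous f})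
  (f0 f1 : R)
  (f0E : f0 = inf [set f x | x in A])
  (f1E : f1 = inf [set f x | x in boundary A])
  (f0_gt0 : 0 < f0)
  (dO : measure_display) (Omega : measurableType dO) (P : probability Omega R)
  (X : nat -> {RV P >-> 'rV[R]_d})
  (X_law : forall i B, measurable B -> distribution P (X i) B = nu B)
  (X_independent : mutually_independent P X)
  (Z : nat -> {RV P >-> nat})
  (Z_law : forall n, (0 < n)%N ->
     forall j, distribution P (Z n) [set j] = (poisson_pmf n%:R j)%:E)
  (Z_independent : forall n, (0 < n)%N -> independent_of_family P (Z n) X)
  (r : nat -> R)
  (r_gt0 : forall n, (0 < n)%N -> 0 < r n)
  (r_lower : n%:R * r n ^+ d @[n --> \oo] --> +oo)
  (r_upper :
     (limn_esup (fun n =>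
        (unit_ball_volume R d * (n%:R * r n ^+ d) / ln n%:R)%:E) <
      (1 / Num.max f0 (d%:R * (f0 - f1 / 2)))%:E)%E)
  (k : nat) (hk : (0 < k)%N) :
  exists2 c : R, 0 < c &
  exists2 eps : R^nat, eps =O_\oo (fun n => expR (- c * (n%:R * r n ^+ d))) &
    \forall n \near \oo,
      ('E_P[count_binomial X r n k])%E =
      (mean_count_poisson P X Z r n k * (1 + eps n)%:E)%E.
Proof.
have [M M0 fM] := compact_density_bound A_compact f_continuous.
have fM' x : msupport nu x -> f x <= M by rewrite nu_support; exact: fM.
have nu_atomless := density_atomless hd nu_density.
have th0 := unit_ball_volume_gt0 R d.
set th := unit_ball_volume R d in r_upper th0.
set mx := Num.max f0 _ in r_upper.
have mx0 : 0 < mx by rewrite lt_max f0_gt0.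
pose u (n : nat) : R := n%:R * r n ^+ d.
(* The bound on [r] eventually gives [th * mx * u n <= ln n], that is [2 * c * u n <= ln n]. *)
pose c : R := th * mx / 2.
have c0 : 0 < c by rewrite divr_gt0// mulr_gt0.
(* Chosen so that [C * u n / n] is the bound [k * (M * (2 * r n) ^+ d)] of [avoid_prob_ge]. *)
pose C : R := k%:R * M * 2 ^+ d.
have C0 : 0 <= C by rewrite !mulr_ge0// exprn_ge0.
pose K : R := (k%:R ^+ 2 + C ^+ 2 + 2 * k%:R * C) * (1 + c^-1 + 4 * c^-2).
have K0 : 0 <= K.
  rewrite mulr_ge0// !addr_ge0 ?sqr_ge0 ?mulr_ge0//.
  - by rewrite invr_ge0 ltW.
  - by rewrite invr_ge0 exprn_ge0// ltW.
pose pb n : R := C * u n / n%:R.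
pose del n : R := k%:R ^+ 2 / n%:R + n%:R * pb n ^+ 2 + 2 * (k%:R * pb n).
pose good n (e : R) := `|e| <= del n /\
  ('E_P[count_binomial X r n k] = mean_count_poisson P X Z r n k * (1 + e)%:E)%E.
have u0 n : (0 < n)%N -> 0 <= u n.
  by move=> n0; rewrite mulr_ge0// exprn_ge0// ltW// r_gt0.
have goodP n : (0 < n)%N -> (k <= n)%N -> k%:R * pb n <= 1 / 2 ->
    exists e, good n e.
  move=> n0 kn kpb.
  have pb0 : 0 <= pb n by rewrite divr_ge0// mulr_ge0// u0.
  have pbE : pb n = k%:R * (M * (2 * r n) ^+ d).
    rewrite /pb /C /u exprMn; field.
    by rewrite pnatr_eq0 -lt0n.
  have [y|e eb eE] := @binomial_mean_approx _ _ _ P _ X nu k (r n) n (pb n)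
    n0 kn pb0 kpb.
    by rewrite pbE; apply: (avoid_prob_ge (f := f)) => //; exact: ltW (r_gt0 n n0).
  exists e; split => //; rewrite /mean_count_poisson unlock /=.
  rewrite (mean_count X_law X_independent nu_atomless hk) eE; congr *%E.
  rewrite (mean_count_random X_law X_independent nu_atomless hk _ (Z_independent n n0)).
  rewrite -(poisson_meanE X nu k (r n) n0).
  by apply: eq_eseriesr => m _; rewrite Z_law.
have u_log : \forall n \near \oo, expR (2 * c * u n) <= n%:R.
  near=> n.
  have n1 : (1 < n)%N by near: n; exact: nbhs_infty_gt.
  have : th * u n / ln n%:R <= 1 / mx.
    near: n; exact: (limn_esup_lt_near r_upper).
  have ln0 : 0 < ln n%:R :> R by rewrite ln_gt0// ltr1n.
  rewrite ler_pdivrMr// div1r ler_pdivlMl// => uln.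
  rewrite -[leRHS]lnK ?posrE ?ltr0n 1?ltnW// ler_expR.
  by apply: le_trans uln; rewrite /c; lra.
have err : \forall n \near \oo, del n <= K * expR (- c * u n).
  near=> n.
  have n0 : (0 < n)%N by near: n; exact: nbhs_infty_gt.
  by apply: error_le_expR => //; [exact: u0|near: n].
(* Beyond this threshold [K <= c * u n <= expR (c * u n)], so the error bound is at most 1. *)
have u_large : \forall n \near \oo, K / c <= u n.
  by move/cvgryPge : r_lower; exact.
(* The smallness of [pb] follows from the error bound itself: [2 * (k * pb n)] is one of the
   nonnegative summands of [del n <= 1]. *)
have small : \forall n \near \oo, k%:R * pb n <= 1 / 2.
  near=> n.
  have n0 : (0 < n)%N by near: n; exact: nbhs_infty_gt.
  have del1 : del n <= 1.
    have : del n <= K * expR (- c * u n) by near: n.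
    move=> /le_trans; apply; rewrite mulNr expRN ler_pdivrMr ?expR_gt0// mul1r.
    apply: le_trans (expR_ge1Dx _).
    have : K / c <= u n by near: n.
    rewrite ler_pdivrMr// => Kc; rewrite (le_trans Kc)// mulrC lerDr//.
  have : 0 <= k%:R ^+ 2 / n%:R + n%:R * pb n ^+ 2 :> R.
    by rewrite addr_ge0// ?divr_ge0 ?exprn_ge0// mulr_ge0// sqr_ge0.
  move: del1; rewrite /del; lra.
(* [choice] needs a witness at every [n]; the value is 0 where no good error exists, which does not
   happen for large [n]. *)
have : forall n, exists e, (exists e, good n e) -> good n e.
  move=> n; have [[e ge]|ng] := pselect (exists e, good n e); first by exists e.
  by exists 0 => /ng.
move=> /choice[eps epsP].
have eps_good : \forall n \near \oo, good n (eps n).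
  near=> n; apply: epsP; apply: goodP; last by near: n.
    by near: n; exact: nbhs_infty_gt.
  by near: n; exact: nbhs_infty_ge.
exists c => //; exists eps; last first.
  by apply: filterS eps_good => n [].
(* The constant must be positive, while [K0] only gives [0 <= K]. *)
apply/eqO_exP; exists (K + 1); first by rewrite ltr_pwDr.
near=> n; rewrite [X in _ * X]ger0_norm ?expR_ge0//.
have [e1 _] : good n (eps n) by near: n.
apply: (le_trans e1); apply: (@le_trans _ _ (K * expR (- c * u n))); first by near: n.
by rewrite ler_wpM2r ?expR_ge0// lerDl.
Unshelve. all: by end_near. Qed.
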